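(* Let $\Gamma^{\#\delta}$ be a graph embedded in the surface $M$ as in the context. Let $v$ be a non-boundary vertex and let $Y$ be the loop-erased random walk started at $v$ and stopped at $\tau_{NC}$. For any simple path $\eta$ started at $v$, either connecting $v$ to a boundary vertex of $\Gamma^{\#\delta}$ or finishing in a noncontractible loop, $$\mathbb P(Y=\eta)=q(\eta)\exp\Big(\Lambda\{\ell\in\mathcal I(\eta):\ \ell\text{ is }\eta\text{-contractible}\}\Big).$$ Likewise, if $\eta_1,\dots,\eta_n$ are candidate paths for the first $n$ steps $Y_1,\dots,Y_n$ of Wilson's algorithm for CRSFs, $$\mathbb P(Y_1=\eta_1,\dots,Y_n=\eta_n)=q\Big(\bigcup_i\eta_i\Big)\exp\Big(\Lambda\big\{\ell\in\mathcal I(\textstyle\bigcup_i\eta_i):\ \ell\text{ is }(\eta_1,\dots,\eta_n)\text{-contractible}\big\}\Big).$$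
   Context: Surface. $M$ is a connected Riemann surface of finite genus $g$ with finitely many ($b$) boundary components, which can be compactified to $\bar M$ by adding a boundary $\partial M$: every point of $\bar M$ has a local chart to $\mathbb C$ (interior points) or to the closed upper half plane (boundary points), and finitely many charts cover $\partial M$. $M$ is either a torus or a hyperbolic surface which is not simply connected, so $\chi=2-2g-b\le0$; put $\mathsf k=|\chi|$. $d_M$ is the distance of a Riemannian metric compatible with the complex structure which extends continuously to $\bar M$ (induced by the constant curvature metric of the universal cover if $\partial M=\emptyset$, and by the analogous metric on the double of $M$ otherwise). $p:\tilde M\to M$ is an analytic universal covering map, where $\tilde M$ is the unit disc $\mathbb D$ (hyperbolic case) or $\mathbb C$ (torus). A closed loop in $M$ is contractible if its lift to $\tilde M$ is closed, and noncontractible otherwise. Graphs. For each $\delta>0$, $\Gamma^{\#\delta}$ is a simple graph with weights $w(e)\geq 0$ on directed edges (no symmetry assumed), faithfully embedded in $M$: it is connected, edges do not cross, there is one marked boundary vertex for each component of $\partial M$ (thought of as lying inside the corresponding hole and joined to the vertices adjacent to that hole), and every face not containing a boundary vertex is a topological disc. Outgoing weights of boundary vertices are $0$. The random walk $X$ jumps from $x$ to $y$ at rate $w_{(x,y)}$; $\tilde\Gamma^{\#\delta}=p^{-1}(\Gamma^{\#\delta})$ and $\tilde X$ is the corresponding walk with lifted weights. Assumptions: (i) Bounded density: there is $C$ independent of $\delta$ such that every $d_M$-ball of radius $\delta$ contains at most $C$ vertices of $\Gamma^{\#\delta}$. (ii) Invariance principle: for every compact $K\subset\tilde M$ containing $0$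 in its interior, $\tilde X$ started from the vertex nearest $0$ and stopped on exiting $K$ converges in law as $\delta\to0$, uniformly up to reparametrisation, to planar Brownian motion from $0$ stopped on exiting $K$. (iii) Uniform crossing: let $R=[0,.3]\times[0,.1]$, $B_1=B((.05,.05),.025)$, $B_2=B((.25,.05),.025)$. There are $\delta_0,\alpha_0>0$ such that for every compact $K\subset M$ there is $\delta_K>0$ such that for all $\delta\in(0,\delta_K)$, all $c\ge\delta/\delta_0$ and $z\in\mathbb R^2$ with $cR+z\subset p^{-1}(K)$, and all vertices $v\in cB_1+z$ of $\tilde\Gamma^{\#\delta}$: $\mathbb P_v(\tilde X \text{ hits } cB_2+z \text{ before exiting } cR+z)>\alpha_0$; likewise with $B_1,B_2$ exchanged and for the vertical rectangle $R'=[0,.1]\times[0,.3]$. (iv) Punctures: $\mathsf k$ distinct interior points $x_i$ with vertices $u_i\neq v_i$ adjacent to the face containing $x_i$ and converging to $x_i$, such that there are paths $\gamma_{u_i},\gamma_{v_i}$ in the graph from $u_i,v_i$ with $M\setminus\bigcup_i(\gamma_{u_i}\cup\gamma_{v_i}\cup(u_i,v_i))$ a disjoint union of annuli (these play no role in the statement). Loops. $q(x\to y)=w_{(x,y)}/\sum_z w_{(x,z)}$ are the transition probabilities of the discrete-time walk; for a path $\gamma=(v_0,\dots,v_n)$, $|\gamma|=n$ and $q(\gamma)=\prod_i q(v_i\to v_{i+1})$; $q(\bigcup\eta_i)$ is the product over all edges of $\bigcup\eta_i$, each counted once. A rooted loop is a path of length $n\ge1$ with $v_n=v_0$ and $q>0$.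 $\Lambda(\ell)=q(\ell)/|\ell|$ is the loop measure on rooted loops, which is re-rooting invariant and so also a measure on unrooted loops. $\mathcal I(S)$ is the set of loops intersecting $S$. Wilson's algorithm. From $v$ run the walk, let $Y^t$ be the chronological loop-erasure of $X[0,t]$, and stop at $\tau_{NC}=\inf\{t: Y^{t-1}\oplus\{X_t\}\text{ contains a noncontractible loop}\}\wedge\tau_\partial$, with $\tau_\partial$ the hitting time of the boundary; set $Y=Y^{\tau_{NC}-1}\oplus X_{\tau_{NC}}$. Subsequent steps start from new vertices and do the same, with all previously sampled branches added to the boundary. $\eta$-contractibility. A rooted loop is Wilson-contractible if all simple loops erased in its chronological loop-erasure started from its root are contractible. Given ordered paths $(\eta_1,\dots,\eta_n)$, a loop $\ell$ is $(\eta_1,\dots,\eta_n)$-contractible if it intersects $\bigcup\eta_i$ and, when re-rooted at (any copy of) the first vertex at which $\eta_1,\dots,\eta_n$, traversed in this order, hits $\ell$, it is Wilson-contractible. *)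

(* Defs.v *)
From HB Require Import structures.
From mathcomp Require Import all_boot all_order all_algebra.
From mathcomp Require Import all_classical all_reals all_analysis.
From mathcomp Require Import complex.

Set Implicit Arguments.
Unset Strict Implicit.
Unset Printing Implicit Defensive.

Import Order.TTheory GRing.Theory Num.Theory.
Import numFieldNormedType.Exports.

Local Open Scope classical_set_scope.
Local Open Scope ring_scope.

(* R[i] seen as a numClosedFieldType, which is what gives it its topology. *)
Definition plane (R : realType) : numClosedFieldType := R[i].

Definition unit_disc (R : realType) : set (plane R) := [set z | `|z| < 1].

Arguments unit_disc R _ : clear implicits.

Definition half_plane (R : realType) : set (plane R) :=
  [set z | 0 <= complex.Im (z : R[i])].

Arguments half_plane R _ : clear implicits.

Definition homeo_on (T U : topologicalType) (A : set T) (B : set U)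
    (h : T -> U) : Prop :=
  [/\ set_bij A B h, {within A, continuous h} &
      forall O, open O -> exists2 O', open O' & h @` (A `&` O) = B `&` O'].

(* Complex differentiability; on an open set it amounts to holomorphy. *)
Definition holo_at (R : realType) (f : plane R -> plane R) (z : plane R) :=
  derivable (f : (plane R)^o -> (plane R)^o) z 1.

Record chart (R : realType) (S : topologicalType) := Chart {
  chart_dom : set S ;
  chart_map :> S -> plane R ;
  chart_model : set (plane R) }.

Definition is_chart (R : realType) (S : topologicalType) (c : chart R S) :=
  [/\ chart_model c = setT \/ chart_model c = half_plane R,
      open (chart_dom c) &
      exists2 O, open O & homeo_on (chart_dom c) (O `&` chart_model c) c].

Definition atlas_boundary (R : realType) (S : topologicalType)
    (A : set (chart R S)) : set S :=
  [set x | exists c, [/\ A c, chart_model c = half_plane R, chart_dom c x &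
                         complex.Im (c x : R[i]) = 0]].

(* A compact connected Riemann surface with boundary.  Compactness makes the
   genus and the number of boundary components finite.  Holomorphy of the
   transition maps is only asked away from the boundary: the charts being
   homeomorphisms, it extends to the boundary by Schwarz reflection. *)
Record bordered_surface (R : realType) := BorderedSurface {
  surf_space :> topologicalType ;
  surf_atlas : set (chart R surf_space) ;
  surf_hausdorff : hausdorff_space surf_space ;
  surf_compact : compact [set: surf_space] ;
  surf_cover : forall x, exists2 c, surf_atlas c & chart_dom c x ;
  surf_chart : forall c, surf_atlas c -> is_chart c ;
  surf_transition : forall c c' x, surf_atlas c -> surf_atlas c' ->
    chart_dom c x -> chart_dom c' x -> ~ atlas_boundary surf_atlas x ->
    exists2 f : plane R -> plane R, holo_at f (c x) &
      \forall y \near x, c' y = f (c y) ;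
  surf_connected : connected (~` atlas_boundary surf_atlas) }.

(* With S the compactification of M, [bdry S] is \partial M and [inter S] is
   M itself. *)
Definition bdry (R : realType) (S : bordered_surface R) : set S :=
  atlas_boundary (@surf_atlas R S).

Arguments bdry {R} S _.

Definition inter (R : realType) (S : bordered_surface R) : set S :=
  ~` bdry S.

Arguments inter {R} S _.

Definition bdry_components (R : realType) (S : bordered_surface R) :
    set (set S) :=
  [set connected_component (bdry S) x | x in bdry S].

Arguments bdry_components {R} S _.

(* [cov_map] is only meaningful on [cov_dom]. *)
Record universal_covering (R : realType) (S : bordered_surface R) :=
  UniversalCovering {
  cov_dom : set (plane R) ;
  cov_map :> plane R -> S ;
  cov_domE : cov_dom = unit_disc R \/ cov_dom = setT ;
  cov_onto : cov_map @` cov_dom = inter S ;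
  cov_analytic : forall c z, surf_atlas c -> cov_dom z ->
    chart_dom c (cov_map z) -> holo_at (fun u => c (cov_map u)) z ;
  cov_even : forall x, inter S x -> exists U : set S,
    [/\ open U, U x, U `<=` inter S &
      exists sheets : set (set (plane R)),
      [/\ \bigcup_(W in sheets) W = cov_dom `&` cov_map @^-1` U,
          trivIset sheets id &
          forall W, sheets W -> open W /\ homeo_on W U cov_map]] }.

(* Curves are parametrised by [0, L]. *)
Definition closed_loop (R : realType) (S : bordered_surface R) (L : R)
    (gamma : R -> S) : Prop :=
  [/\ {within `[0, L], continuous gamma},
      forall t, 0 <= t <= L -> inter S (gamma t) & gamma 0 = gamma L].

Definition is_lift (R : realType) (S : bordered_surface R)
    (p : universal_covering S) (L : R) (gamma : R -> S)
    (g : R -> plane R) : Prop :=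
  {within `[0, L], continuous g} /\
  forall t, 0 <= t <= L -> cov_dom p (g t) /\ p (g t) = gamma t.

(* The covering is normal, so one lift of a loop is closed iff all of them
   are. *)
Definition contractible (R : realType) (S : bordered_surface R)
    (p : universal_covering S) (L : R) (gamma : R -> S) : Prop :=
  exists2 g, is_lift p L gamma g & g 0 = g L.

Definition torus_or_hyperbolic (R : realType) (S : bordered_surface R)
    (p : universal_covering S) : Prop :=
  (cov_dom p = setT /\ bdry S = set0) \/
  (cov_dom p = unit_disc R /\
   exists L (gamma : R -> S),
     [/\ 0 < L, closed_loop L gamma & ~ contractible p L gamma]).

(* [pos] is meaningful for non-boundary vertices and [hole] for boundary
   vertices.  A boundary vertex lies inside its hole, so an edge leading to it
   is drawn up to the point where it reaches the corresponding component of
   the boundary of the surface, and the faces containing a boundary vertex are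
   those whose closure meets that boundary.  The vertices are finitely many
   because they have bounded density in a compact surface. *)
Record embedded_graph (R : realType) (S : bordered_surface R) :=
  EmbeddedGraph {
  vert :> finType ;
  bdv : {set vert} ;
  adj : rel vert ;
  adj_sym : symmetric adj ;
  adj_irr : irreflexive adj ;
  adj_connected : forall x y, connect adj x y ;
  wt : vert -> vert -> R ;
  wt_ge0 : forall x y, 0 <= wt x y ;
  wt_adj : forall x y, ~~ adj x y -> wt x y = 0 ;
  wt_bdv : forall x y, x \in bdv -> wt x y = 0 ;
  pos : vert -> S ;
  pos_inter : forall x, x \notin bdv -> inter S (pos x) ;
  pos_inj : forall x y, x \notin bdv -> y \notin bdv -> pos x = pos y -> x = y ;
  hole : vert -> set S ;
  hole_bij : set_bij [set x | x \in bdv] (bdry_components S) hole ;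
  edge : vert -> vert -> R -> S ;
  edge_cont : forall x y, adj x y -> {within `[0, 1], continuous (edge x y)} ;
  edge_rev : forall x y t, adj x y -> 0 <= t <= 1 ->
    edge y x t = edge x y (1 - t) ;
  edge_src : forall x y, adj x y ->
    if x \in bdv then hole x (edge x y 0) else edge x y 0 = pos x ;
  edge_inter : forall x y t, adj x y -> 0 < t < 1 -> inter S (edge x y t) ;
  edge_vert : forall x y z t, adj x y -> 0 < t < 1 -> z \notin bdv ->
    edge x y t <> pos z ;
  edge_cross : forall x y x' y' s t, adj x y -> adj x' y' ->
    0 < s < 1 -> 0 < t < 1 -> edge x y s = edge x' y' t ->
    [/\ x' = x, y' = y & t = s] \/ [/\ x' = y, y' = x & t = 1 - s] ;
  face_disc :
    let support := [set pos x | x in [set x | x \notin bdv]] `|`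
      \bigcup_(e in [set e : vert * vert | adj e.1 e.2])
        (edge e.1 e.2 @` `[0, 1]) in
    forall x, (inter S `\` support) x ->
    let F := connected_component (inter S `\` support) x in
    closure F `&` bdry S = set0 ->
    exists h : plane R -> S, homeo_on (unit_disc R) F h }.

Section Walk.
Variables (R : realType) (S : bordered_surface R).
Variables (p : universal_covering S) (G : embedded_graph S).
Implicit Types (x y : G) (s c Y eta : seq G) (B : {set G}).
Implicit Types (etas : seq (seq G)).

(* A vertex of zero total rate holds the walk; holding is a constant curve. *)
Definition edge_curve x y : R -> S :=
  if x == y then cst (pos x) else edge x y.

(* The concatenation, on [0, n], of the edges of a walk s = (v_0, ..., v_n)
   with n >= 1; [x] is only a default value. *)
Definition walk_curve x s (t : R) : S :=
  let i := minn (Num.truncn t) (size s).-2 in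
  edge_curve (nth x s i) (nth x s i.+1) (t - i%:R).

Definition contractible_walk x s : Prop :=
  contractible p (size s).-1%:R (walk_curve x s).

Definition total_wt x : R := \sum_y wt x y.

Definition q x y : R := wt x y / total_wt x.

(* Transition matrix of the jump chain: the walk never leaves a vertex of zero
   total rate, in particular a boundary vertex. *)
Definition jump x y : R := if total_wt x == 0 then (x == y)%:R else q x y.

Definition steps s : seq (G * G) := zip s (behead s).

Definition q_path s : R := \prod_(e <- steps s) q e.1 e.2.

Definition jump_path s : R := \prod_(e <- steps s) jump e.1 e.2.

Definition q_union etas : R :=
  \prod_(e in [set e in flatten (map steps etas)]%SET) q e.1 e.2.

Definition le_step Y x : seq G :=
  if x \in Y then take (index x Y).+1 Y else rcons Y x.

(* Chronological loop-erasure. *)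
Definition loop_erase s : seq G := foldl le_step [::] s.

(* The loop closed when the simple path Y is extended by a vertex x of Y. *)
Definition loop_at Y x : seq G := rcons (drop (index x Y) Y) x.

Definition closes_NC Y x : bool :=
  (x \in Y) && `[< ~ contractible_walk x (loop_at Y x) >].

(* For a trajectory X, [mkseq X t] is (X_0, ..., X_{t-1}). *)
Definition stops B (X : nat -> G) (t : nat) : bool :=
  (X t \in B) || closes_NC (loop_erase (mkseq X t)) (X t).

Definition tau_NC B (X : nat -> G) : option nat :=
  if pselect (exists t, stops B X t) is left stopped
  then Some (ex_minn stopped) else None.

(* The branch Y; it is undefined (None) if the walk never stops. *)
Definition branch B (X : nat -> G) : option (seq G) :=
  omap (fun t => rcons (loop_erase (mkseq X t)) (X t)) (tau_NC B X).

Definition explored etas : {set G} := bdv G :|: [set x in flatten etas]%SET.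

(* The first n branches of Wilson's algorithm.  [start] chooses the new
   starting vertex from the branches already sampled, and X v is the walk run
   from v: no vertex is ever used twice as a starting point, so each step uses
   a walk that has not been looked at before. *)
Fixpoint wilson (start : seq (seq G) -> G) (X : G -> nat -> G) (n : nat) :
    option (seq (seq G)) :=
  if n is m.+1 then
    obind (fun etas => omap (rcons etas)
                         (branch (explored etas) (X (start etas))))
          (wilson start X m)
  else Some [::].

Definition starts_new (start : seq (seq G) -> G) : Prop :=
  forall etas, explored etas != [set: G]%SET -> start etas \notin explored etas.

(* A simple path from v which ends in B or in a noncontractible loop (its last
   vertex being then its only repetition). *)
Definition branch_path B v eta : Prop :=
  exists s x, [/\ eta = rcons s x, head x eta = v, path (@adj _ _ G) v (behead eta),
    uniq s & (x \notin s) && (x \in B) || closes_NC s x].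

Definition candidates (start : seq (seq G) -> G) etas : Prop :=
  forall i, (i < size etas)%N ->
  let prev := take i etas in
  let eta := nth [::] etas i in
  [/\ start prev \notin explored prev,
      branch_path (explored prev) (start prev) eta &
      forall j, (j.+1 < size eta)%N -> nth (start prev) eta j \notin explored prev].

(* A rooted loop (v_0, ..., v_n) with v_n = v_0 is encoded by
   c = (v_0, ..., v_{n-1}); its length is [size c] and re-rooting is [rot]. *)
Definition loop_path c : seq G := if c is x :: _ then rcons c x else [::].

Definition rooted_loop c : bool := (0 < size c)%N && (0 < q_path (loop_path c)).

Definition Lambda (A : set (seq G)) : \bar R :=
  \esum_(c in [set c | rooted_loop c] `&` A)
    (q_path (loop_path c) / (size c)%:R)%:E.

Definition wilson_contractible c : Prop :=
  forall t x, (t < size (loop_path c))%N ->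
  ~~ closes_NC (loop_erase (take t (loop_path c))) (nth x (loop_path c) t).

Definition intersects (A : {set G}) : set (seq G) :=
  [set c | has (mem A) c].

(* [first_hit] is the first vertex of c met when traversing eta_1, ..., eta_n
   in this order; [x] is only a default value. *)
Definition first_hit etas c x : G :=
  nth x (flatten etas) (find (mem c) (flatten etas)).

Definition eta_contractible etas : set (seq G) :=
  [set c | intersects [set x in flatten etas]%SET c /\
    forall i x, (i < size c)%N -> nth x c i = first_hit etas c x ->
      wilson_contractible (rot i c)].

End Walk.

Section Law.
Variables (R : realType) (S : bordered_surface R) (G : embedded_graph S).
Variables (d : measure_display) (T : measurableType d) (P : probability T R).

Definition random_walk (v : G) (X : nat -> T -> G) : Prop :=
  (forall t x, measurable [set w | X t w = x]) /\
  forall s : seq G,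
    P [set w | mkseq (X ^~ w) (size s).+1 = v :: s] = (jump_path (v :: s))%:E.

(* Independent random walks X v, one started from each vertex v. *)
Definition independent_walks (X : G -> nat -> T -> G) : Prop :=
  (forall v t x, measurable [set w | X v t w = x]) /\
  forall s : G -> seq G,
    P [set w | forall v, mkseq (X v ^~ w) (size (s v)).+1 = v :: s v] =
    (\prod_v jump_path (v :: s v))%:E.

End Law.

(* Main.v *)
(* Cut a trajectory whose loop-erasure is (y_1, ..., y_m) at the last visits to
   y_1, y_2, ...: it is the path itself, with a loop rooted at y_i and avoiding
   the boundary and y_1, ..., y_{i-1} inserted at each y_i.  Whether a closed
   simple loop is contractible only depends on that loop, so the walk is not
   stopped iff each inserted loop is Wilson-contractible.  Hence
   P(Y = eta) = q(eta) prod_i G_i, with G_i the total weight of the loops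
   insertable at y_i.  Cutting such a loop at its visits to y_i shows that G_i =
   sum_k f^k = 1 / (1 - f), with f the weight of one excursion.  On the other
   hand Lambda(c) = q(c) / |c|, so sharing the mass of a loop among its visits to
   y_i, the loops whose first hit is y_i have mass sum_{k > 0} f^k / k =
   - log (1 - f).  For Wilson's algorithm the same factors are multiplied along
   the successive branches. *)

Require Import Defs.
From mathcomp Require Import all_boot all_order all_algebra.
From mathcomp Require Import all_classical all_reals all_analysis.

Set Implicit Arguments.
Unset Strict Implicit.
Unset Printing Implicit Defensive.

Import Order.TTheory GRing.Theory Num.Theory.
Import numFieldNormedType.Exports.

Local Open Scope classical_set_scope.
Local Open Scope ring_scope.
Local Open Scope ereal_scope.

(** * Unordered sums and the logarithm series *)

Lemma esumZl (R : realType) (I : choiceType) (D : set I) (c : \bar R)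
    (a : I -> \bar R) :
  0 <= c -> (forall i, 0 <= a i) ->
  \esum_(i in D) (c * a i) = c * \esum_(i in D) a i.
Proof.
move=> c0 a0; case: c c0 => [r|_|//].
  rewrite lee_fin => r0; rewrite /esum -ereal_supZl //; last first.
    by apply/set0P; exists (\sum_(i \in set0) a i), set0 => //; exact: fsets_set0.
  rewrite image_comp; congr ereal_sup; apply: eq_imagel => F _.
  by rewrite /= ge0_mule_fsumr.
(* For [c = +oo], both sides are [+oo] as soon as one term is nonzero, and both are [0]
   otherwise. *)
have [[i Di ai0]|all0] := pselect (exists2 i, D i & a i != 0).
  have ai : 0 < a i by rewrite lt_neqAle eq_sym ai0 a0.
  have le1 (b : I -> \bar R) : (forall j, 0 <= b j) -> b i <= \esum_(j in D) b j.
    move=> b0; rewrite (esumID [set i]) // setIidr ?esum_set1 //; last by move=> _ ->.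
    by rewrite leeDl // esum_ge0.
  rewrite gt0_mulye; last exact: lt_le_trans (le1 _ a0).
  apply/eqP; rewrite -leye_eq.
  apply: le_trans (le1 (fun i => +oo * a i) _); first by rewrite gt0_mulye.
  by move=> j; rewrite mule_ge0.
have z i : D i -> a i = 0.
  by move=> Di; apply/eqP/negP => /negP ai; apply: all0; exists i.
by rewrite !esum1 ?mule0 // => i /z ->; rewrite mule0.
Qed.

Lemma esumM (R : realType) (I J : choiceType) (D : set I) (E : set J)
    (a : I -> \bar R) (b : J -> \bar R) :
  (forall i, 0 <= a i) -> (forall j, 0 <= b j) ->
  (\esum_(i in D) a i) * (\esum_(j in E) b j) =
  \esum_(k in D `*` E) (a k.1 * b k.2).
Proof.
move=> a0 b0.
transitivity (\esum_(i in D) \esum_(j in E) (a i * b j)).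
  rewrite muleC -esumZl ?esum_ge0 //; apply: eq_esum => i Di.
  by rewrite esumZl // muleC.
by rewrite esum_esum // => i j _ _; rewrite mule_ge0.
Qed.

Lemma esum_ltn (R : realType) (n : nat) (P : pred nat) (a : nat -> \bar R) :
  (forall i, (i < n)%N -> P i -> 0 <= a i) ->
  \esum_(i in [set i | (i < n)%N /\ P i]) a i = \sum_(i < n | P i) a i.
Proof.
move=> a0.
rewrite (_ : [set i | _] = `I_n `&` [set i | P i]); last by [].
rewrite esum_mkcondr esum_fset //; last first.
  by move=> i /set_mem ni; case: ifP => // /set_mem; exact: a0.
rewrite -fsbig_ord [RHS]big_mkcond; apply: eq_bigr => i _.
by rewrite (_ : (nat_of_ord i \in _) = P i) //; apply/idP/idP => [/set_mem|/mem_set].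
Qed.

(** Countable additivity is carried over from [nat] along [pickle]. The index sets in view are sets
    of finite words over the vertices. *)
Lemma measure_countable_bigcup (R : realType) d (T : measurableType d)
    (mu : {measure set T -> \bar R}) (I : countType) (D : set I)
    (F : I -> set T) :
  (forall i, D i -> measurable (F i)) -> trivIset D F ->
  measurable (\bigcup_(i in D) F i) /\
  mu (\bigcup_(i in D) F i) = \esum_(i in D) mu (F i).
Proof.
move=> mF tF.
pose F' n := if unpickle n is Some i then F i else set0.
have F'K i : F' (pickle i) = F i by rewrite /F' pickleK.
have E : \bigcup_(i in D) F i = \bigcup_(n in pickle @` D) F' n.
  by rewrite bigcup_image; apply: eq_bigcupr => i _; rewrite F'K.
have mF' n : (pickle @` D) n -> measurable (F' n).
  by case=> i Di <-; rewrite F'K; exact: mF.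
split; first by rewrite E; exact: bigcup_measurable.
rewrite E measure_bigcup //; last first.
  by move=> _ _ [i Di <-] [j Dj <-]; rewrite !F'K => /(tF _ _ Di Dj) ->.
rewrite nneseries_esum // set_mem_set esum_image; last first.
  by move=> i j _ _; exact: (pcan_inj pickleK).
by apply: eq_esum => i _; rewrite F'K.
Qed.

(** * The logarithm and geometric series *)

Section log_series.
Variable R : realType.
Implicit Types (f x : R) (n : nat).
Local Open Scope ring_scope.

(** A partial sum of the series of [- ln (1 - x)]; the constant coefficient is [0^-1 = 0], as it
    should be. *)
Definition log_poly n : {poly R} := \poly_(i < n) i%:R^-1.

Lemma log_polyE n x : (log_poly n).[x] = \sum_(0 <= k < n) x ^+ k / k%:R.
Proof. by rewrite horner_poly big_mkord; apply: eq_bigr => i _; rewrite mulrC. Qed.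

Lemma deriv_log_poly n x : x != 1 ->
  (log_poly n.+1)^`().[x] = (1 - x ^+ n) / (1 - x).
Proof.
move=> x1; have x1' : 1 - x != 0 by rewrite subr_eq0 eq_sym.
have -> : (log_poly n.+1)^`() = \poly_(i < n) 1.
  apply/polyP => i; rewrite coef_deriv !coef_poly ltnS.
  by case: ifP => _; rewrite ?mul0rn // -(mulr_natr _^-1) mulVf // pnatr_eq0.
rewrite horner_poly; under eq_bigr do rewrite mul1r.
by apply: (mulIf x1'); rewrite divfK // -[1 - x ^+ n]opprB subrX1 -mulNr opprB mulrC.
Qed.

(** Mean value theorem for the difference [h], which vanishes at [0] and has derivative
    [- y ^+ n / (1 - y)]; the absolute value of the latter increases with [y], and the length of the
    interval is at most 1. *)
Lemma log_poly_le n x : 0 <= x < 1 ->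
  `|(log_poly n.+1).[x] + ln (1 - x)| <= x ^+ n / (1 - x).
Proof.
case/andP=> x0 x1.
pose h (y : R) := (log_poly n.+1).[y] + ln (1 - y).
have dh (y : R) : y < 1 -> is_derive y (1 : R) h (- (y ^+ n / (1 - y))).
  move=> y1; have y1' : 0 < 1 - y by rewrite subr_gt0.
  have dln : is_derive y (1 : R) (fun y => ln (1 - y)) (- (1 - y)^-1).
    have d1 : is_derive y (1 : R) (fun y : R => 1 - y) (-1).
      have := is_deriveB (is_derive_cst (1 : R) y (1 : R)) (is_derive_id y (1 : R)).
      by rewrite sub0r.
    have d2 := is_derive1_ln y1'.
    have := @is_derive1_comp R (@ln R) (fun y : R => 1 - y) y _ _ d2 d1.
    by rewrite mulrN1.
  apply: is_derive_eq; rewrite deriv_log_poly ?lt_eqF // mulrBl div1r.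
  by rewrite addrAC subrr add0r.
have [| |c] := @MVT_segment _ h (fun y => - (y ^+ n / (1 - y))) 0 x x0.
- by move=> y /[!in_itv]/= /andP[_ yx]; apply: dh; exact: lt_trans x1.
- apply: derivable_within_continuous => y /[!in_itv]/= /andP[_ yx].
  by apply: ex_derive; apply: dh; exact: le_lt_trans x1.
rewrite in_itv /= => /andP[c0 cx].
have -> : h 0 = 0.
  rewrite /h subr0 ln1 addr0 log_polyE big_nat_recl // expr0 invr0 mulr0 add0r.
  by rewrite big1 // => i _; rewrite expr0n /= mul0r.
rewrite !subr0 -[_ + ln _]/(h x) => ->.
have c1 : 0 < 1 - c by rewrite subr_gt0 (le_lt_trans cx).
have x1' : 0 < 1 - x by rewrite subr_gt0.
have q0 : 0 <= c ^+ n / (1 - c) by rewrite divr_ge0 ?exprn_ge0 // ltW.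
rewrite normrM normrN !ger0_norm // -[leRHS]mulr1 ler_pM //; last exact: ltW.
rewrite ler_pM ?exprn_ge0 ?invr_ge0 ?(ltW c1) // ?lerXn2r ?nnegrE //.
by rewrite lef_pV2 ?posrE // lerB.
Qed.

Lemma nneseries_log f : 0 <= f < 1 ->
  (\sum_(k <oo) (f ^+ k / k%:R)%:E = (- ln (1 - f))%:E)%E.
Proof.
move=> /andP[f0 f1]; apply: cvg_lim => //.
rewrite (_ : (fun n => _) =
    EFin \o (fun n => \sum_(0 <= k < n) f ^+ k / k%:R)); last first.
  by apply/funext => n /=; rewrite sumEFin.
apply: cvg_EFin; first exact: nearW.
rewrite -(cvg_shiftS) /=.
apply/cvgrPdist_le => e e0.
have : (fun n => f ^+ n / (1 - f)) @ \oo --> (0 : R).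
  rewrite -[X in _ --> X](mul0r (1 - f)^-1); apply: cvgMr_tmp.
  by apply: cvg_expr; rewrite ger0_norm.
move/cvgrPdist_le => /(_ _ e0); apply: filterS => n /=.
rewrite sub0r normrN => le_e; rewrite -opprD normrN addrC -log_polyE.
apply: le_trans (log_poly_le _ _) _; first by rewrite f0.
exact: le_trans (ler_norm _) le_e.
Qed.

Lemma nneseries_geometric f : 0 <= f < 1 ->
  (\sum_(k <oo) (f ^+ k)%:E = ((1 - f)^-1)%:E)%E.
Proof.
move=> /andP[f0 f1]; apply: cvg_lim => //.
rewrite (_ : (fun n => _) = EFin \o series (geometric 1 f)); last first.
  apply/funext => n /=; rewrite sumEFin; congr EFin.
  by apply: eq_bigr => k _; rewrite /geometric /= mul1r.
apply: cvg_EFin; first exact: nearW.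
by rewrite -[X in _ --> X]mul1r; apply: cvg_geometric_series; rewrite ger0_norm.
Qed.

(** If [f] were at least 1, the sum of the first [n] terms would be at least [n]. Finiteness of the
    sum is what will be known about excursions. *)
Lemma nneseries_expn_lt1 f : 0 <= f ->
  (\sum_(k <oo) (f ^+ k)%:E < +oo)%E -> f < 1.
Proof.
move=> f0 fin; rewrite ltNge; apply/negP => f1.
have le_n n : (n%:R%:E <= \sum_(k <oo) (f ^+ k)%:E)%E.
  have f0' k : (0 <= k)%N -> true -> (0 <= (f ^+ k)%:E)%E.
    by move=> _ _; rewrite lee_fin exprn_ge0.
  apply: le_trans (nneseries_lim_ge n f0').
  rewrite sumEFin lee_fin -[n in leLHS]card_ord -sumr_const big_mkord.
  by apply: ler_sum => i _; rewrite exprn_ege1.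
case: (\sum_(k <oo) _)%E fin le_n => [r _ le_n|//|_ /(_ 0%N) //].
have := le_n (Num.truncn r).+1; rewrite lee_fin leNgt => /negP; apply.
by rewrite -truncn_le_nat.
Qed.

Lemma expeR_log_series f : 0 <= f ->
  (\sum_(k <oo) (f ^+ k)%:E < +oo ->
   expeR (\sum_(k <oo) (f ^+ k / k%:R)%:E) = \sum_(k <oo) (f ^+ k)%:E)%E.
Proof.
move=> f0 fin; have f1 : 0 <= f < 1 by rewrite f0 nneseries_expn_lt1.
rewrite nneseries_log // nneseries_geometric //= expRN lnK // posrE subr_gt0.
by case/andP: f1.
Qed.

End log_series.

(** * Loop-erasure of trajectories *)

Section LoopErasure.
Variables (R : realType) (S : bordered_surface R).
Variables (p : universal_covering S) (G : embedded_graph S).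
Implicit Types (x y z : G) (s t u l c Y : seq G) (A : {set G}).
Local Open Scope nat_scope.

(** The current erased path [Y] is a parameter so that a walk can be cut and resumed in the
    middle. *)
Fixpoint contractible_run Y s : bool :=
  if s is x :: s' then
    ~~ closes_NC p Y x && contractible_run (le_step Y x) s'
  else true.

Lemma closes_NC_mem Y x : closes_NC p Y x -> x \in Y.
Proof. by case/andP. Qed.

Lemma le_step_cat u Y x : x \notin u -> le_step (u ++ Y) x = u ++ le_step Y x.
Proof.
move=> xu; rewrite /le_step mem_cat index_cat (negbTE xu) /=.
case: ifP => _; last by rewrite rcons_cat.
by rewrite -addnS take_cat ltnNge leq_addr /= addKn.
Qed.

(** The loop closed by [x] starts at the earlier visit to [x], which lies beyond [u], so the prefix
    is not seen. *)
Lemma closes_NC_cat u Y x :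
  x \notin u -> closes_NC p (u ++ Y) x = closes_NC p Y x.
Proof.
move=> xu; rewrite /closes_NC /loop_at mem_cat index_cat (negbTE xu) /=.
by rewrite drop_cat ltnNge leq_addr /= addKn.
Qed.

Lemma foldl_le_step_cat u Y s : all (fun x => x \notin u) s ->
  foldl (@le_step _ _ _) (u ++ Y) s = u ++ foldl (@le_step _ _ _) Y s.
Proof.
elim: s Y => //= x s IHs Y /andP[xu su].
by rewrite le_step_cat // IHs.
Qed.

Lemma contractible_run_catl u Y s : all (fun x => x \notin u) s ->
  contractible_run (u ++ Y) s = contractible_run Y s.
Proof.
elim: s Y => //= x s IHs Y /andP[xu su].
by rewrite le_step_cat // IHs // closes_NC_cat.
Qed.

Lemma contractible_run_cat Y s t : contractible_run Y (s ++ t) =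
  contractible_run Y s && contractible_run (foldl (@le_step _ _ _) Y s) t.
Proof. by elim: s Y => //= x s IHs Y; rewrite IHs andbA. Qed.

Lemma last_le_step z Y x : last z (le_step Y x) = x.
Proof.
rewrite /le_step; case: ifP => xY; last by rewrite last_rcons.
by rewrite (take_nth x) ?index_mem // last_rcons nth_index.
Qed.

Lemma mem_le_step Y x : x \in le_step Y x.
Proof.
rewrite /le_step; case: ifP => xY; last by rewrite mem_rcons mem_head.
by rewrite (take_nth x) ?index_mem // nth_index // mem_rcons mem_head.
Qed.

Lemma last_foldl_le_step z Y s :
  last z (foldl (@le_step _ _ _) Y s) = last (last z Y) s.
Proof. by elim: s Y => //= x s IHs Y; rewrite IHs last_le_step. Qed.

Lemma le_step_uniq Y x : uniq Y -> uniq (le_step Y x).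
Proof.
rewrite /le_step; case: ifP => [_|xY] Yu; first exact: take_uniq.
by rewrite rcons_uniq xY.
Qed.

Lemma loop_erase_uniq s : uniq (loop_erase s).
Proof.
rewrite /loop_erase; have: uniq ([::] : seq G) by [].
by elim: s [::] => //= x s IHs Y Yu; apply: IHs; apply: le_step_uniq.
Qed.

Lemma foldl_le_step_cons y Y s :
  exists r, foldl (@le_step _ _ _) (y :: Y) s = y :: r.
Proof.
elim: s Y => [|x s IHs] Y /=; first by exists Y.
rewrite /le_step; case: ifP => _; last exact: IHs.
by rewrite /=; exact: IHs.
Qed.

Lemma loop_erase_head x s : exists r, loop_erase (x :: s) = x :: r.
Proof. exact: foldl_le_step_cons. Qed.

(** The erased path is simple, still starts at [y], and ends where the walk ends, which is [y]
    again; hence it is a single vertex. *)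
Lemma foldl_le_step_loop y l :
  last y l = y -> foldl (@le_step _ _ _) [:: y] l = [:: y].
Proof.
move=> ly; have [r E] := foldl_le_step_cons y [::] l.
have U : uniq (y :: r) by rewrite -E; exact: (loop_erase_uniq (y :: l)).
have := last_foldl_le_step y [:: y] l; rewrite /= ly E.
case: r {E} U => //= z r /andP[yr _] L.
by rewrite -{1}L mem_last in yr.
Qed.

Lemma loop_erase_rcons s x : loop_erase (rcons s x) = le_step (loop_erase s) x.
Proof. by rewrite /loop_erase -cats1 foldl_cat. Qed.

(* The splitting point is the last visit of the walk to u. *)
Lemma loop_erase_split s u y r : loop_erase s = u ++ y :: r ->
  exists s' l, [/\ s = s' ++ y :: l, loop_erase s' = u &
                   all (fun x => x \notin u) (y :: l)].
Proof.
elim/last_ind: s r => [|s z IHs] r; first by case: u.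
have U := loop_erase_uniq s; rewrite loop_erase_rcons => E.
have Lz : last y (u ++ y :: r) = z by rewrite -E last_le_step.
have zu : z \notin u.
  have := le_step_uniq z U; rewrite E cat_uniq => /and3P[_ /hasPn H _].
  by apply: H; rewrite -Lz last_cat /= mem_last.
(* If [z] closes a loop, the erasure of [s] prolongs [u ++ y :: r], and the induction hypothesis is
   used with this longer tail. *)
move: E; rewrite /le_step; case: ifP => zs E.
  have [|s' [l [-> Eu av]]] := IHs (r ++ drop (index z (loop_erase s)).+1 (loop_erase s)).
    by rewrite -cat_cons catA -E cat_take_drop.
  exists s', (rcons l z); split => //; first by rewrite -cats1 -catA cat_cons cats1.
  by rewrite -rcons_cons all_rcons zu.
(* Now [z] is appended to the erasure. If [r] is empty then [z] is [y], and the cut falls just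
   before this last vertex. *)
case/lastP: r E Lz => [|r z'] E Lz.
  move: E; rewrite cats1 => /rcons_inj[Eu Ez].
  by exists s, [::]; rewrite cats1 Ez /= -Ez zu.
move: E; rewrite -rcons_cons -rcons_cat => /rcons_inj[Es _].
have [s' [l [-> Eu av]]] := IHs _ Es.
exists s', (rcons l z); split => //; first by rewrite -cats1 -catA cat_cons cats1.
by rewrite -rcons_cons all_rcons zu.
Qed.

(** * Decomposition of a trajectory along its loop-erasure *)

Definition trajectories A u : set (seq G) :=
  [set s | [/\ contractible_run [::] s, all (fun x => x \notin A) s &
               loop_erase s = u]].

(** The root is not listed in [l]: the empty list is the trivial loop, and loops at [y] are composed
    by concatenating lists. *)
Definition loops A y : set (seq G) :=
  [set l | [/\ contractible_run [:: y] l, all (fun x => x \notin A) (y :: l) &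
               last y l = y]].

Lemma trajectories_nil A : trajectories A [::] = [set [::]].
Proof.
apply/seteqP; split => [s [_ _]|_ -> //].
by case: s => // x s; have [r ->] := loop_erase_head x s.
Qed.

Lemma trajectories_last A z u s : trajectories A (z :: u) s ->
  exists s', s = z :: s' /\ last z s' = last z u.
Proof.
case: s => [|a s] [_ _] //; have [r Er] := loop_erase_head a s.
rewrite Er => -[? ?]; subst a r; exists s; split => //.
have := last_foldl_le_step z [::] (z :: s).
by rewrite -[foldl _ _ _]/(loop_erase (z :: s)) Er.
Qed.

Lemma avoidsU A u s : all (fun x => x \notin A :|: [set x in u]%SET) s =
  all (fun x => x \notin A) s && all (fun x => x \notin u) s.
Proof. by rewrite -all_predI; apply: eq_all => x /=; rewrite !inE negb_or. Qed.

(** Cut after the last visit to [u]. From then on the walk starts at [y], ends at [y] and avoids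
    [u], so it is a loop at [y]. *)
Lemma trajectories_rcons A u y : y \notin u ->
  set_bij (trajectories A u `*` loops (A :|: [set x in u]%SET) y)
    (trajectories A (rcons u y)) (fun k => k.1 ++ y :: k.2).
Proof.
move=> yu; have lu : le_step u y = u ++ [:: y] by rewrite /le_step (negbTE yu) cats1.
split.
- move=> [s l] /= [[rs As Es] [rl]]; rewrite avoidsU => /andP[Al ul] ll.
  split => /=.
  + rewrite contractible_run_cat rs /= -/(loop_erase s) Es.
    rewrite (contra (@closes_NC_mem _ _) yu) /= lu.
    by rewrite contractible_run_catl //; case/andP: ul.
  + by rewrite all_cat As.
  + rewrite /loop_erase foldl_cat -/(loop_erase s) Es /= lu.
    rewrite foldl_le_step_cat ?foldl_le_step_loop ?cats1 //.
    by case/andP: ul.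
(* The cut is unique: if [s2] were longer than [s1], its last vertex, which belongs to [u], would
   lie in [y :: l1], which avoids [u]. *)
- have aux s1 l1 s2 l2 : trajectories A u s2 -> all (fun x => x \notin u) (y :: l1) ->
      s1 ++ y :: l1 = s2 ++ y :: l2 -> size s2 <= size s1.
    move=> T2 u1 E; rewrite leqNgt; apply/negP => lt.
    have : u = loop_erase s2 by case: T2.
    case/lastP: s2 T2 E lt => // s2 z T2 E lt Eu.
    have zu : z \in u by rewrite Eu loop_erase_rcons mem_le_step.
    have : z \in y :: l1.
      have -> : y :: l1 = drop (size s1) (rcons s2 z ++ y :: l2).
        by rewrite -E drop_size_cat.
      rewrite drop_cat lt mem_cat drop_rcons ?mem_rcons ?inE ?eqxx //.
      by rewrite size_rcons in lt.
    by move/(allP u1); rewrite zu.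
  move=> [s1 l1] [s2 l2] /set_mem[/= T1 [_ + _]] /set_mem[/= T2 [_ + _]] E.
  rewrite !avoidsU => /andP[_ u1] /andP[_ u2].
  have Es : size s1 = size s2.
    by apply/eqP; rewrite eqn_leq (aux _ _ _ _ T2 u1 E) (aux _ _ _ _ T1 u2 (esym E)).
  by move/eqP: E; rewrite eqseq_cat // => /andP[/eqP-> /eqP[->]].
- move=> s [rs As Es].
  have [|s' [l [E Eu av]]] := @loop_erase_split s u y [::]; first by rewrite cats1.
  move: rs As; rewrite E contractible_run_cat all_cat -/(loop_erase s') Eu.
  move=> /andP[rs' /= /andP[_]] rl /andP[As' Al].
  have ul : all (fun x => x \notin u) l by case/andP: av.
  rewrite lu contractible_run_catl // in rl.
  exists (s', l); last by [].
  split; first by split.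
  split; [by []|by rewrite avoidsU av andbT; exact: Al|].
  have := last_foldl_le_step y [:: y] l; move: Es.
  rewrite E /loop_erase foldl_cat -/(loop_erase s') Eu /= lu foldl_le_step_cat // -cats1.
  by move/eqP; rewrite eqseq_cat // eqxx => /eqP -> /= <-.
Qed.

End LoopErasure.

(** * Weights of trajectories and loops *)

Section Weights.
Variables (R : realType) (S : bordered_surface R).
Variables (p : universal_covering S) (G : embedded_graph S).
Implicit Types (x y z : G) (s t u l c Y : seq G) (A : {set G}).

Lemma q_ge0 x y : (0 <= q x y)%R.
Proof. by rewrite divr_ge0 ?wt_ge0 // sumr_ge0 // => z _; exact: wt_ge0. Qed.

Lemma q_path_ge0 s : (0 <= q_path s)%R.
Proof. by rewrite prodr_ge0 // => e _; exact: q_ge0. Qed.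

Lemma q_path_seq1 x : q_path [:: x] = 1%R :> R.
Proof. by rewrite /q_path /steps /= big_nil. Qed.

Lemma q_path_cons x y s : q_path [:: x, y & s] = (q x y * q_path (y :: s))%R.
Proof. by rewrite /q_path /steps /= big_cons. Qed.

Lemma q_path_cat x s t :
  q_path (x :: s ++ t) = (q_path (x :: s) * q_path (last x s :: t))%R.
Proof.
elim: s x => [|y s IHs] x /=; first by rewrite q_path_seq1 mul1r.
by rewrite !q_path_cons IHs mulrA.
Qed.

Lemma q_path_rcons x s y :
  q_path (rcons (x :: s) y) = (q_path (x :: s) * q (last x s) y)%R.
Proof. by rewrite -cats1 q_path_cat q_path_cons q_path_seq1 mulr1. Qed.

Lemma jump_path_cons x y s :
  jump_path [:: x, y & s] = (jump x y * jump_path (y :: s))%R.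
Proof. by rewrite /jump_path /steps /= big_cons. Qed.

(* A walk that holds at a vertex never leaves it, so the two transition matrices
   agree on a path whose last step moves. *)
Lemma jump_path_q v t x : x != last v t ->
  jump_path (rcons (v :: t) x) = q_path (rcons (v :: t) x).
Proof.
elim: t v => [|y t IHt] v /= xl.
  rewrite jump_path_cons q_path_cons /jump /q; case: eqP => [->|_] //.
    by rewrite eq_sym (negbTE xl) invr0 mulr0 !mul0r.
  by rewrite /jump_path /q_path /steps /= !big_nil.
rewrite jump_path_cons q_path_cons; have := IHt y xl; rewrite rcons_cons => ->.
rewrite /jump; case: eqP => // v0; have qv z : q v z = 0%R by rewrite /q v0 invr0 mulr0.
case: eqP => [<-|_]; last by rewrite qv.
by case: t {IHt xl} => [|z t]; rewrite q_path_cons !qv !mul0r mulr0.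
Qed.

(** The Green function at [y] of the walk killed on [A], restricted to Wilson-contractible loops. *)
Definition loop_sum A y : \bar R := \esum_(l in loops p A y) (q_path (y :: l))%:E.

Definition loop_prod : {set G} -> seq G -> \bar R :=
  fix loop_prod A u :=
    if u is y :: u' then loop_sum A y * loop_prod (y |: A)%SET u' else 1.

Lemma loop_prod_cat A u u' :
  loop_prod A (u ++ u') = loop_prod A u * loop_prod (A :|: [set x in u])%SET u'.
Proof.
elim: u A => [|y u IHu] A /=.
  by rewrite mul1e; congr loop_prod; apply/setP => x; rewrite !inE orbF.
rewrite IHu muleA; congr (_ * loop_prod _ _); apply/setP => x; rewrite !inE.
by rewrite orbCA orbA.
Qed.

Lemma loop_sum_ge0 A y : 0 <= loop_sum A y.
Proof. by rewrite esum_ge0 // => l _; rewrite lee_fin q_path_ge0. Qed.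

Lemma loop_prod_ge0 A u : 0 <= loop_prod A u.
Proof. by elim: u A => //= y u IHu A; rewrite mule_ge0 ?loop_sum_ge0. Qed.

(** The trivial loop has weight 1. Thanks to this bound, finiteness of a product of loop weights
    passes to each factor. *)
Lemma loop_sum_ge1 A y : y \notin A -> 1 <= loop_sum A y.
Proof.
move=> yA; rewrite -(q_path_seq1 y) /loop_sum.
rewrite (esumID [set [::]]); last by move=> l _; rewrite lee_fin q_path_ge0.
rewrite setIidr ?esum_set1 ?lee_fin ?q_path_ge0 //; last first.
  by move=> _ ->; split => //=; rewrite yA.
by rewrite leeDl // esum_ge0 // => l _; rewrite lee_fin q_path_ge0.
Qed.

Lemma esum_trajectories A u : uniq u ->
  \esum_(s in trajectories p A u) (q_path s)%:E = (q_path u)%:E * loop_prod A u.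
Proof.
elim/last_ind: u => [|u y IHu].
  move=> _; rewrite /= mule1 trajectories_nil.
  by rewrite esum_set1 // lee_fin q_path_ge0.
rewrite rcons_uniq => /andP[yu {}/IHu IHu].
rewrite (reindex_esum _ _ _ _ (trajectories_rcons p A yu)) -cats1 loop_prod_cat /= mule1.
rewrite cats1; set L := loops _ _ _.
have lsE : loop_sum (A :|: [set x in u])%SET y =
    \esum_(l in L) (q_path (y :: l))%:E by [].
(* When [u] is empty the part before [y] is the empty walk, and no edge into [y] has to be
   counted. *)
case: u yu @L IHu lsE => [|z u] yu L IHu lsE.
  rewrite /= mul1e q_path_seq1 mul1e lsE.
  transitivity (\esum_(k in trajectories p A [::] `*` L)
      (1 * (q_path (y :: k.2))%:E)).
    by rewrite trajectories_nil; apply: eq_esum => -[s l] /= [-> _]; rewrite mul1e.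
  rewrite -(@esumM R _ _ _ _ (fun=> 1) (fun l => (q_path (y :: l))%:E)) //; last first.
    by move=> l; rewrite lee_fin q_path_ge0.
  by rewrite trajectories_nil esum_set1 ?mul1e.
transitivity (\esum_(k in trajectories p A (z :: u) `*` L)
    ((q_path k.1)%:E * ((q (last z u) y)%:E * (q_path (y :: k.2))%:E))).
  apply: eq_esum => -[s l] /= [/trajectories_last[s' [-> <-]] _].
  by rewrite cat_cons q_path_cat q_path_cons !EFinM.
rewrite -(@esumM R _ _ _ _ (fun s => (q_path s)%:E)
    (fun l => (q (last z u) y)%:E * (q_path (y :: l))%:E)); last 2 first.
- by move=> s; rewrite lee_fin q_path_ge0.
- by move=> l; rewrite mule_ge0 // lee_fin ?q_path_ge0 ?q_ge0.
rewrite esumZl ?lee_fin ?q_ge0 //; last by move=> l; rewrite lee_fin q_path_ge0.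
by rewrite IHu -lsE -/(loop_prod _ _) q_path_rcons EFinM muleACA.
Qed.

Lemma esum_trajectories_rcons A z u x : uniq (z :: u) ->
  \esum_(s in trajectories p A (z :: u)) (q_path (rcons s x))%:E =
  (q_path (rcons (z :: u) x))%:E * loop_prod A (z :: u).
Proof.
move=> uu; rewrite q_path_rcons mulrC EFinM -muleA -esum_trajectories //.
rewrite -esumZl ?lee_fin ?q_ge0 //; last by move=> l; rewrite lee_fin q_path_ge0.
apply: eq_esum => s /trajectories_last[s' [-> <-]].
by rewrite q_path_rcons EFinM muleC.
Qed.

(** As the root is not listed, [k] is the number of returns to [y], hence of excursions; [k = 0]
    leaves only the trivial loop. *)
Definition loops_count A y k : set (seq G) :=
  [set l | loops p A y l /\ count_mem y l = k].

Definition loop_sum_count A y k : \bar R :=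
  \esum_(l in loops_count A y k) (q_path (y :: l))%:E.

(** At each return to [y] the erased path is [y] alone again, so the two pieces are tested for
    contractibility independently. *)
Lemma loops_cat A y l1 l2 : loops p A y (l1 ++ l2) -> last y l1 = y ->
  loops p A y l1 /\ loops p A y l2.
Proof.
move=> [/= r /andP[yA]] + + ly; rewrite all_cat last_cat ly => /andP[A1 A2] l2y.
move: r; rewrite contractible_run_cat foldl_le_step_loop // => /andP[r1 r2].
by split; split => //=; rewrite yA.
Qed.

Lemma cat_loops A y l1 l2 :
  loops p A y l1 -> loops p A y l2 -> loops p A y (l1 ++ l2).
Proof.
move=> [r1 A1 ly1] [r2 /andP[_ A2] ly2]; split.
- by rewrite contractible_run_cat foldl_le_step_loop // r1.
- by rewrite -cat_cons all_cat A1.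
- by rewrite last_cat ly1.
Qed.

Lemma loops_count0 A y : y \notin A -> loops_count A y 0 = [set [::]].
Proof.
move=> yA; apply/seteqP; split => [l [[_ _ ly] /eqP]|_ -> /=].
  rewrite eqn0Ngt -has_count has_pred1; case: l ly => //= a l <-.
  by rewrite mem_last.
by split => //; split => //=; rewrite yA.
Qed.

Lemma loops_countS A y k :
  set_bij (loops_count A y 1 `*` loops_count A y k) (loops_count A y k.+1)
    (fun j => j.1 ++ j.2).
Proof.
(* The first excursion is recovered as the prefix that ends at the first occurrence of [y]. *)
have aux l1 l2 : loops_count A y 1 l1 ->
    l1 = take (index y (l1 ++ l2)).+1 (l1 ++ l2).
  move=> [[_ _ ly] c1].
  case/lastP: l1 c1 ly => // a z + zy; rewrite last_rcons in zy; subst z.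
  rewrite -cats1 count_cat /= eqxx addn0 addn1 => -[/eqP].
  rewrite eqn0Ngt -has_count has_pred1 => ya.
  rewrite -catA /= index_cat (negbTE ya) /= eqxx addn0.
  by rewrite take_cat ltnNge leqnSn /= subSnn /= take0.
split.
- move=> [l1 l2] /= [[L1 c1] [L2 c2]]; split; first exact: cat_loops.
  by rewrite count_cat c1 c2.
- move=> [l1 l2] [l1' l2'] /set_mem[/= L1 _] /set_mem[/= L1' _] E.
  have E1 : l1 = l1' by rewrite (aux _ l2 L1) E -(aux _ l2' L1').
  by subst l1'; move/eqP: E; rewrite eqseq_cat // eqxx => /eqP ->.
- move=> l [L c].
  have yl : y \in l by rewrite -has_pred1 has_count c.
  have [ya lE] : y \notin take (index y l) l /\
      l = rcons (take (index y l) l) y ++ drop (index y l).+1 l.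
    split; last first.
      rewrite -[X in rcons _ X](nth_index y yl).
      by rewrite -take_nth ?index_mem // cat_take_drop.
    by rewrite in_take_leq ?index_size // ltnn.
  move: ya lE; set a := take _ _; set b := drop _ _ => ya lE.
  have ca : count_mem y (rcons a y) = 1%N.
    rewrite -cats1 count_cat /= eqxx addn0; apply/eqP; rewrite addn1 eqSS.
    by rewrite eqn0Ngt -has_count has_pred1.
  clearbody a b; subst l; move: L c => L.
  have [|L1 L2] := loops_cat L; first by rewrite last_rcons.
  by rewrite count_cat ca => -[cb]; exists (rcons a y, b).
Qed.

Lemma loop_sum_countS A y k :
  loop_sum_count A y k.+1 = loop_sum_count A y 1 * loop_sum_count A y k.
Proof.
rewrite /loop_sum_count (reindex_esum _ _ _ _ (loops_countS A y k)).
rewrite esumM; last 2 first.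
- by move=> l; rewrite lee_fin q_path_ge0.
- by move=> l; rewrite lee_fin q_path_ge0.
apply: eq_esum => -[l1 l2] [/= [[_ _ ly] _] _].
by rewrite q_path_cat ly EFinM.
Qed.

(** The weight [phi] is left free to cover two cases: constant 1 for the geometric series and [k^-1]
    for the logarithm. *)
Lemma esum_loops A y (phi : nat -> R) : (forall k, 0 <= phi k)%R ->
  \esum_(l in loops p A y) (phi (count_mem y l) * q_path (y :: l))%:E =
  \sum_(k <oo) (phi k)%:E * loop_sum_count A y k.
Proof.
move=> phi0.
rewrite (_ : loops p A y = \bigcup_k loops_count A y k); last first.
  by apply/seteqP; split => [l L|l [k _ []] //]; exists (count_mem y l).
rewrite nneseries_sum_bigcup; last 2 first.
- by move=> i j _ _ [l [[_ <-] [_ <-]]].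
- by move=> l; rewrite lee_fin mulr_ge0 ?q_path_ge0.
apply: eq_eseriesr => k _; rewrite -esumZl ?lee_fin //; last first.
  by move=> l; rewrite lee_fin q_path_ge0.
by apply: eq_esum => l [_ ->]; rewrite EFinM.
Qed.

(* A loop visiting y k times after time 0 is a list of k excursions from y, so
   with f the weight of one excursion the two sides are exp(sum_k f^k / k) and
   sum_k f^k. *)
Lemma expeR_loops A y : y \notin A -> loop_sum A y < +oo ->
  expeR (\esum_(l in loops p A y) (q_path (y :: l) / (count_mem y l)%:R)%:E) =
  loop_sum A y.
Proof.
move=> yA fin.
have g1 : loop_sum_count A y 1 \is a fin_num.
  rewrite ge0_fin_numE; last by rewrite esum_ge0 // => l _; rewrite lee_fin q_path_ge0.
  apply: le_lt_trans fin; rewrite /loop_sum (esumID (loops_count A y 1)); last first.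
    by move=> l _; rewrite lee_fin q_path_ge0.
  rewrite setIidr; last by move=> l [].
  by rewrite leeDl // esum_ge0 // => l _; rewrite lee_fin q_path_ge0.
have [f fE] : exists f, loop_sum_count A y 1 = f%:E.
  by exists (fine (loop_sum_count A y 1)); rewrite fineK.
have f0 : (0 <= f)%R.
  by rewrite -lee_fin -fE esum_ge0 // => l _; rewrite lee_fin q_path_ge0.
have gk k : loop_sum_count A y k = (f ^+ k)%:E.
  elim: k => [|k IHk]; last by rewrite loop_sum_countS IHk fE exprS EFinM.
  by rewrite /loop_sum_count loops_count0 // esum_set1 ?q_path_seq1 // lee_fin q_path_ge0.
have GE : loop_sum A y = \sum_(k <oo) (f ^+ k)%:E.
  rewrite /loop_sum; under eq_esum do rewrite -[q_path _]mul1r.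
  rewrite (@esum_loops _ _ (fun=> 1%R)) //.
  by apply: eq_eseriesr => k _; rewrite gk mul1e.
rewrite GE -expeR_log_series -?GE //; congr expeR.
under eq_esum do rewrite mulrC.
(* The trivial loop, with [k = 0], gets the factor [0^-1 = 0], in accordance with the logarithm
   series. *)
rewrite (@esum_loops _ _ (fun k => k%:R^-1)%R); last by move=> k; rewrite invr_ge0.
by apply: eq_eseriesr => k _; rewrite gk -EFinM mulrC.
Qed.

End Weights.

(** * The loop measure *)

Section LoopMeasure.
Variables (R : realType) (S : bordered_surface R).
Variables (p : universal_covering S) (G : embedded_graph S).
Implicit Types (x y z : G) (s t u l c Y : seq G) (A : {set G}).
Local Open Scope nat_scope.

Lemma wilson_contractibleP c :
  wilson_contractible p c <-> contractible_run p [::] (loop_path c).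
Proof.
rewrite /wilson_contractible /loop_erase; move: (loop_path c) [::] => s Y.
elim: s Y => [|x s IHs] Y /=; first by split => // _ [].
split=> [H|/andP[cx /IHs H] [|t] z] /=; last by rewrite ltnS => ts; exact: H.
  by rewrite (H 0 x) //=; apply/IHs => t z ts; exact: (H t.+1).
by [].
Qed.

Lemma rot_nth y c i : i < size c -> exists r, rot i c = nth y c i :: r.
Proof. by move=> ic; rewrite /rot (drop_nth y ic); eexists. Qed.

Lemma q_path_rot n c : q_path (loop_path (rot n c)) = q_path (loop_path c) :> R.
Proof.
elim: n => [|n IHn]; first by rewrite rot0.
have [ltn|len] := ltnP n (size c); last by rewrite rot_oversize // ltnW.
rewrite rotS // -IHn; case: (rot n c) => [|x [|y s]] //.
rewrite rot1_cons /loop_path rcons_cons.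
by rewrite -!rcons_cons !q_path_rcons /= q_path_cons last_rcons mulrC mulrA.
Qed.

(** Re-rooting at another visit to [y] exchanges two consecutive loops at [y]. *)
Lemma loops_rot A y a m r : loops p A y (rcons a y) ->
  rot m (y :: a) = y :: r -> loops p A y (rcons r y).
Proof.
move=> L; have [len|ltn] := leqP (size (y :: a)) m.
  by rewrite rot_oversize // => -[<-].
have := cat_take_drop m (y :: a); rewrite /rot.
move: (take m _) (drop m _) => [|z a1] [|z' a2] //.
- by rewrite cats0 cat0s => -> [<-].
- by rewrite cats0 cat0s => -> [<-].
move=> [-> aE] [zE <-]; move: L; rewrite -aE zE.
rewrite rcons_cat rcons_cons -cat_rcons => L.
have [|L1 L2] := loops_cat L; first by rewrite last_rcons.
by rewrite rcons_cat rcons_cons -cat_rcons; exact: cat_loops.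
Qed.

(** The test is asked at every copy of [y]; by [loops_rot] it holds at all of them once it holds at
    one. *)
Definition loops_through A y : set (seq G) :=
  [set c | [/\ all (fun x => x \notin A) c, y \in c &
    forall i, i < size c -> nth y c i = y -> wilson_contractible p (rot i c)]].

Lemma wilson_contractible_loops A y a : all (fun x => x \notin A) (y :: a) ->
  wilson_contractible p (y :: a) <-> loops p A y (rcons a y).
Proof.
move=> yaA; rewrite wilson_contractibleP; split=> [r|[r _ _]]; last exact: r.
split; rewrite ?last_rcons //.
by rewrite -rcons_cons all_rcons yaA andbT; case/andP: yaA.
Qed.

(** [belast y l] is the cyclic word of the loop read from its root, and [rotr j] puts that root at
    time [j]; rotating back by [j] is the inverse. The trivial loop admits no [j] and disappears. *)
Lemma rot_loops_bij A y :
  set_bij (loops p A y `*`` (fun l => [set j | j < size l]%classic))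
    (loops_through A y `*`` (fun c => [set j | j < size c /\ nth y c j == y]%classic))
    (fun k => (rotr k.2 (belast y k.1), k.2)).
Proof.
split.
- move=> [l j] /= [L jl].
  have [a lE] : exists a, l = rcons a y.
    case/lastP: l L jl => // a z [_ _]; rewrite last_rcons => -> _.
    by exists a.
  subst l; rewrite belast_rcons; have [_ + _] := L.
  rewrite -rcons_cons all_rcons => /andP[_ yaA].
  set c := rotr j (y :: a).
  have sc : size c = size (y :: a) by rewrite size_rotr.
  have jc : j < size c by rewrite sc /=; rewrite size_rcons in jl.
  have cE : rot j c = y :: a by rewrite rotrK.
  have cjy : nth y c j = y by have [r] := rot_nth y jc; rewrite cE => -[].
  split; split => //=; last by rewrite cjy.
  + by rewrite -(eq_all_r (mem_rot j c)) cE.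
  + by rewrite -(mem_rot j) cE mem_head.
  + move=> i ic ciy; have [r] := rot_nth y ic; rewrite ciy => rE.
    have [m mE] : exists m, rot i c = rot m (y :: a).
      rewrite /c /rotr rot_add_mod ?leq_subr //; first by eexists.
      by rewrite -sc ltnW.
    rewrite rE; apply/(wilson_contractible_loops (A := A)).
      by rewrite -rE mE (eq_all_r (mem_rot m _)).
    by apply: (loops_rot L (m := m)); rewrite -mE.
- move=> [l j] [l' j'] /set_mem[/= [_ _ ly] _] /set_mem[/= [_ _ ly'] _] [E jj].
  subst j'; congr pair; move: (can_inj (@rotrK j _) E) => bE.
  have := lastI y l; rewrite bE ly => E1.
  by have := lastI y l'; rewrite ly' -E1 => -[].
- move=> [c j] /= [[cA yc H] [jc /eqP cj]].
  have [a] := rot_nth y jc; rewrite cj => rE.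
  exists (rcons a y, j) => /=.
    split; last by rewrite size_rcons -[(size a).+1]/(size (y :: a)) -rE size_rot.
    apply/wilson_contractible_loops.
      by rewrite -rE (eq_all_r (mem_rot j c)).
    by rewrite -rE; exact: H.
  by rewrite belast_rcons -rE rotK.
Qed.

Local Open Scope ring_scope.
Local Open Scope ereal_scope.

Lemma sum_nth_const y c (r : R) :
  \sum_(j < size c | nth y c j == y) r%:E = (r * (count_mem y c)%:R)%:E.
Proof.
rewrite sumEFin; congr EFin.
rewrite -(big_mkord (fun j => nth y c j == y) (fun=> r)).
rewrite -(big_nth y (fun x => x == y) (fun=> r)).
by rewrite big_const_seq iter_addr addr0 mulr_natr.
Qed.

(* The pairs (c, j) such that c visits y at time j are obtained by rotating the
   loops rooted at y by all j smaller than their length.  Summing over them with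
   weight 1 / (length * number of visits to y) trades the division by the length
   for the division by the number of visits. *)
Lemma esum_loops_through A y :
  \esum_(c in loops_through A y) (q_path (loop_path c) / (size c)%:R)%:E =
  \esum_(l in loops p A y) (q_path (y :: l) / (count_mem y l)%:R)%:E.
Proof.
pose w c := (q_path (loop_path c) / (size c)%:R / (count_mem y c)%:R)%R.
have w0 c : 0 <= (w c)%:E by rewrite lee_fin !divr_ge0 // q_path_ge0.
transitivity (\esum_(c in loops_through A y)
    \esum_(j in [set j | (j < size c)%N /\ nth y c j == y]) (w c)%:E).
  apply: eq_esum => c [_ yc _]; rewrite esum_ltn // sum_nth_const divfK //.
  by rewrite pnatr_eq0 -lt0n -has_count has_pred1.
rewrite esum_esum // (reindex_esum _ _ _ _ (rot_loops_bij A y)).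
rewrite -(esum_esum (a := fun l j => (w (rotr j (belast y l)))%:E)) //.
apply: eq_esum => l [_ _ ly].
have bE : rcons (belast y l) y = y :: l by rewrite lastI ly.
have countb : count_mem y (belast y l) = count_mem y l.
  apply: (@addIn 1%N); have := congr1 (count_mem y) bE.
  by rewrite -cats1 count_cat /= eqxx addn0 addnC addn1 add1n.
have wE j : w (rotr j (belast y l)) =
    (q_path (y :: l) / (size l)%:R / (count_mem y l)%:R)%R.
  rewrite /w size_rotr size_belast -countb.
  rewrite (permP (_ : perm_eq (rotr j (belast y l)) (belast y l))) ?perm_rotr //.
  rewrite /rotr q_path_rot; congr (_ / _ / _)%R.
  by rewrite -bE; case: (l) ly => //= a l' _; rewrite q_path_seq1.
under eq_esum do rewrite wE.
rewrite (_ : [set j | _] = [set j | (j < size l)%N /\ predT j]); last first.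
  by apply/seteqP; split => j //= -[].
rewrite esum_ltn; last by move=> j _ _; rewrite lee_fin !divr_ge0 ?q_path_ge0.
rewrite sumEFin sumr_const card_ord -(mulr_natr (_ / _ / _)%R); congr EFin.
have [l0|l0] := eqVneq l [::]; first by rewrite l0 /= invr0 !mulr0.
by rewrite mulrAC divfK // pnatr_eq0 size_eq0.
Qed.

(** Every vertex of a loop has an outgoing edge of positive weight, and boundary vertices have
    none. *)
Lemma rooted_loop_bdv c : rooted_loop c -> all (fun x => x \notin bdv G) c.
Proof.
case: c => // y a /andP[_]; rewrite /loop_path rcons_cons => /lt0r_neq0.
have : forall z s, q_path (z :: s) != 0%R :> R ->
    all (fun x => x \notin bdv G) (belast z s).
  move=> z s; elim: s z => //= x s IHs z; rewrite q_path_cons mulf_eq0 negb_or.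
  move=> /andP[qz /IHs ->]; rewrite andbT; apply: contra qz => zb.
  by rewrite /q wt_bdv // mul0r.
by move=> /[apply]; rewrite belast_rcons.
Qed.

(** The forbidden set [A] makes a recursion on [u] possible: a vertex that has been treated moves
    from [u] to [A]. *)
Definition first_hit_loops A u : set (seq G) :=
  [set c | [/\ all (fun x => x \notin A) c, has (mem u) c &
    forall i x, (i < size c)%N -> nth x c i = nth x u (find (mem c) u) ->
      wilson_contractible p (rot i c)]].

(** The words that are not rooted loops contribute 0, either by a vanishing weight or, for the empty
    word, by the inverse of its length 0. *)
Lemma Lambda_esum (A : set (seq G)) :
  Lambda A = \esum_(c in A) (q_path (loop_path c) / (size c)%:R)%:E.
Proof.
rewrite /Lambda esum_mkcondl; apply: eq_esum => c _; case: ifPn => //.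
rewrite notin_setE /= /rooted_loop => /negP; rewrite negb_and -!leqNgt leqn0.
case/orP => [/eqP ->|]; first by rewrite invr0 mulr0.
move=> q0; have -> : q_path (loop_path c) = 0%R :> R; last by rewrite mul0r.
by apply/le_anti; rewrite leNgt q0 q_path_ge0.
Qed.

Lemma first_hit_loops1 A y :
  first_hit_loops A [:: y] = loops_through A y.
Proof.
apply/seteqP; split => c [cA].
  move=> yc H.
  have {}yc : y \in c by case/hasP: yc => x xc; rewrite /= inE => /eqP <-.
  by split => // i ic ciy; apply: (H i y) => //=; rewrite yc.
move=> yc H; split => //; first by apply/hasP; exists y => //=; exact: mem_head.
by move=> i x ic; rewrite /= yc /= (set_nth_default y) // => ciy; exact: H.
Qed.

(** Loops through [y] have [y] as first hit; for those that avoid [y] the first hit is decided by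
    [u]. *)
Lemma Lambda_first_hit_cons A y u : Lambda (first_hit_loops A (y :: u)) =
  Lambda (first_hit_loops A [:: y]) + Lambda (first_hit_loops (y |: A)%SET u) :> \bar R.
Proof.
rewrite !Lambda_esum (esumID [set c : seq G | y \in c]); last first.
  by move=> c _; rewrite lee_fin divr_ge0 ?q_path_ge0.
congr (_ + _); [congr (\esum_(c in _) _)|congr (\esum_(c in _) _)].
  rewrite first_hit_loops1; apply/seteqP; split => c.
    move=> [[cA _ H] /= yc]; split => // i ic ciy.
    by apply: (H i y) => //=; rewrite yc.
  move=> [cA yc H]; split => //; split => //.
    by apply/hasP; exists y => //=; exact: mem_head.
  by move=> i x ic; rewrite /= yc /= (set_nth_default y) // => ciy; exact: H.
apply/seteqP; split => c.
  move=> [[cA hc H] /= /negP yc]; split.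
  - apply/allP => x xc; rewrite !inE negb_or (allP cA) // andbT.
    by apply: contraNneq yc => <-.
  - case/hasP: hc => x xc; rewrite /= inE => /orP[/eqP xy|xu].
      by rewrite -xy xc in yc.
    by apply/hasP; exists x.
  - by move=> i x ic cix; apply: (H i x) => //=; rewrite (negbTE yc).
move=> [cA hc H].
have yc : y \notin c by apply/negP => /(allP cA); rewrite !inE eqxx.
split; last exact/negP; split.
- by apply/allP => x /(allP cA); rewrite !inE negb_or => /andP[].
- by case/hasP: hc => x xc xu; apply/hasP; exists x => //=; rewrite inE; apply/orP; right.
- by move=> i x ic; rewrite /= (negbTE yc) /=; exact: H.
Qed.

Definition loop_exp A u : \bar R := expeR (Lambda (first_hit_loops A u)).

Lemma loop_exp_nil A : loop_exp A [::] = 1.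
Proof.
rewrite /loop_exp (_ : first_hit_loops A [::] = set0).
  by rewrite Lambda_esum esum_set0 expeR0.
by apply/seteqP; split => // c [_ /hasP[]].
Qed.

Lemma loop_exp_cons A y u :
  loop_exp A (y :: u) = loop_exp A [:: y] * loop_exp (y |: A)%SET u.
Proof. by rewrite /loop_exp Lambda_first_hit_cons expeRD. Qed.

Lemma loop_exp_cat A u u' :
  loop_exp A (u ++ u') = loop_exp A u * loop_exp (A :|: [set x in u])%SET u'.
Proof.
elim: u A => [|y u IHu] A /=.
  rewrite loop_exp_nil mul1e; congr loop_exp; apply/setP => x.
  by rewrite !inE orbF.
rewrite loop_exp_cons IHu muleA -loop_exp_cons; congr (_ * loop_exp _ _).
by apply/setP => x; rewrite !inE orbCA orbA.
Qed.

Lemma loop_exp1_visited A y : y \in A -> loop_exp A [:: y] = 1.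
Proof.
move=> yA; rewrite /loop_exp first_hit_loops1 (_ : loops_through A y = set0).
  by rewrite Lambda_esum esum_set0 expeR0.
by apply/seteqP; split => // c [cA /(allP cA)]; rewrite yA.
Qed.

Lemma loop_exp1 A y :
  y \notin A -> loop_sum p A y < +oo -> loop_exp A [:: y] = loop_sum p A y.
Proof.
move=> yA fin; rewrite /loop_exp first_hit_loops1 Lambda_esum.
by rewrite esum_loops_through expeR_loops.
Qed.

Lemma loop_prod_ge1 A u : uniq u -> all (fun x => x \notin A) u ->
  1 <= loop_prod p A u.
Proof.
elim: u A => [|y u IHu] A //= /andP[yu uu] /andP[yA uA].
rewrite -[X in X <= _]mule1 lee_pmul ?loop_sum_ge1 // IHu //.
apply/allP => x xu; rewrite !inE negb_or (allP uA) // andbT.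
by apply: contraNneq yu => <-.
Qed.

Lemma loop_prod_exp A u : uniq u -> all (fun x => x \notin A) u ->
  loop_prod p A u < +oo -> loop_prod p A u = loop_exp A u.
Proof.
elim: u A => [|y u IHu] A; first by rewrite loop_exp_nil.
move=> /= /andP[yu uu] /andP[yA uA].
have uA' : all (fun x => x \notin (y |: A)%SET) u.
  apply/allP => x xu; rewrite !inE negb_or (allP uA) // andbT.
  by apply: contraNneq yu => <-.
have g1 := loop_sum_ge1 p yA; have P1 := loop_prod_ge1 uu uA'.
move=> fin; rewrite loop_exp_cons -IHu // ?loop_exp1 //.
- apply: le_lt_trans fin; rewrite -[X in X <= _]mule1 lee_pmul //.
  exact: loop_sum_ge0.
- apply: le_lt_trans fin; rewrite -[X in X <= _]mul1e lee_pmul //.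
  exact: loop_prod_ge0.
Qed.

End LoopMeasure.

(** * The law of one branch *)

Section BranchLaw.
Variables (R : realType) (S : bordered_surface R).
Variables (p : universal_covering S) (G : embedded_graph S).
Variables (d : measure_display) (T : measurableType d) (P : probability T R).
Implicit Types (x v : G) (s t eta : seq G) (B : {set G}) (etas : seq (seq G)).

Lemma not_stopped B (X : nat -> G) n :
  (forall i, (i < n)%N -> ~~ stops p B X i) <->
  contractible_run p [::] (mkseq X n) && all (fun x => x \notin B) (mkseq X n).
Proof.
elim: n => [|n IHn]; first by split.
rewrite mkseqS all_rcons -cats1 contractible_run_cat /= andbT.
transitivity (~~ stops p B X n /\ forall i, (i < n)%N -> ~~ stops p B X i).
  split=> [H|[Hn H] i]; first by split=> [|i /ltnW]; apply: H.
  by rewrite ltnS leq_eqVlt => /orP[/eqP ->|/H].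
rewrite IHn /stops negb_or -/(loop_erase _); split.
  by move=> [/andP[-> ->] /andP[-> ->]].
by move=> /andP[/andP[-> ->] /andP[-> ->]].
Qed.

(** The stopping test sees only the erased path and the new vertex, so every unstopped trajectory
    with erasure [s] is stopped by a step to [x], and not earlier. *)
Lemma branchP B (X : nat -> G) s x : (x \in B) || closes_NC p s x ->
  branch p B X = Some (rcons s x) <->
  exists2 t, trajectories p B s t & mkseq X (size t).+1 = rcons t x.
Proof.
move=> sx; rewrite /branch /tau_NC; split.
  case: pselect => // st; case: ex_minnP => n _ nmin /= [/rcons_inj[Es Ex]].
  exists (mkseq X n); last by rewrite size_mkseq mkseqS Ex.
  have /not_stopped/andP[rn an] : forall i, (i < n)%N -> ~~ stops p B X i.
    by move=> i; rewrite ltnNge; apply: contra; exact: nmin.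
  by split.
move=> [t [rt at_ Et]]; rewrite mkseqS => /rcons_inj[tE Ex].
have st : stops p B X (size t) by rewrite /stops tE Ex Et.
case: pselect => [st'|[]]; last by exists (size t).
case: ex_minnP => n stn nmin /=.
suff -> : n = size t by rewrite tE Ex Et.
apply/eqP; rewrite eqn_leq nmin //= leqNgt; apply/negP => nt.
have /not_stopped/(_ _ nt) : contractible_run p [::] (mkseq X (size t)) &&
    all (fun x => x \notin B) (mkseq X (size t)) by rewrite tE rt.
by rewrite stn.
Qed.

(** The longer trajectory would already have been stopped at the end of the shorter one. This makes
    the cylinder events disjoint. *)
Lemma trajectories_prefix_free B (X : nat -> G) s x t t' :
  (x \in B) || closes_NC p s x ->
  trajectories p B s t -> mkseq X (size t).+1 = rcons t x ->
  trajectories p B s t' -> mkseq X (size t').+1 = rcons t' x -> t = t'.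
Proof.
move=> sx.
have aux t1 t2 : trajectories p B s t1 -> mkseq X (size t1).+1 = rcons t1 x ->
    trajectories p B s t2 -> mkseq X (size t2).+1 = rcons t2 x ->
    (size t2 <= size t1)%N.
  move=> [r1 a1 E1]; rewrite mkseqS => /rcons_inj[t1E X1].
  move=> [r2 a2 E2]; rewrite mkseqS => /rcons_inj[t2E X2].
  rewrite leqNgt; apply/negP => t12.
  have /not_stopped/(_ _ t12) : contractible_run p [::] (mkseq X (size t2)) &&
      all (fun x => x \notin B) (mkseq X (size t2)) by rewrite t2E r2.
  by rewrite /stops t1E X1 E1 sx.
move=> T1 M1 T2 M2; have /eqP E : size t == size t'.
  by rewrite eqn_leq (aux _ _ T1 M1 T2 M2) (aux _ _ T2 M2 T1 M1).
by move: M1; rewrite E M2 => /rcons_inj[].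
Qed.

Lemma measurable_mkseq (X : nat -> T -> G) n s :
  (forall i x, measurable [set w | X i w = x]) ->
  measurable [set w | mkseq (X ^~ w) n = s].
Proof.
move=> mX; elim: n s => [|n IHn] s.
  have [->|/eqP s0] := eqVneq s [::].
    by rewrite (_ : [set w | _] = setT) //; apply/seteqP; split.
  by rewrite (_ : [set w | _] = set0) //; apply/seteqP; split => // w /esym.
case/lastP: s => [|s x].
  by rewrite (_ : [set w | _] = set0) //; apply/seteqP; split.
rewrite (_ : [set w | _] = [set w | mkseq (X ^~ w) n = s] `&` [set w | X n w = x]).
  exact: measurableI.
apply/seteqP; split => w /=; rewrite mkseqS; first by move=> /rcons_inj[].
by move=> [-> ->].
Qed.

Lemma branch_event (X : nat -> T -> G) B s x :
  (forall i x, measurable [set w | X i w = x]) ->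
  (x \in B) || closes_NC p s x ->
  measurable [set w | branch p B (X ^~ w) = Some (rcons s x)] /\
  forall E, measurable E ->
  P (E `&` [set w | branch p B (X ^~ w) = Some (rcons s x)]) =
  \esum_(t in trajectories p B s)
    P (E `&` [set w | mkseq (X ^~ w) (size t).+1 = rcons t x]).
Proof.
move=> mX sx.
have eqU : [set w | branch p B (X ^~ w) = Some (rcons s x)] =
    \bigcup_(t in trajectories p B s)
      [set w | mkseq (X ^~ w) (size t).+1 = rcons t x].
  apply/seteqP; split => w /=.
    by move=> /(branchP _ sx)[t tT tX]; exists t.
  by move=> [t tT tX]; apply/(branchP _ sx); exists t.
have mcyl t : measurable [set w | mkseq (X ^~ w) (size t).+1 = rcons t x].
  exact: measurable_mkseq.
have triv E : trivIset (trajectories p B s)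
    (fun t => E `&` [set w | mkseq (X ^~ w) (size t).+1 = rcons t x]).
  move=> t t' tT t'T [w [[_ M] [_ M']]].
  exact: trajectories_prefix_free sx tT M t'T M'.
split.
  rewrite eqU.
  have [] // := @measure_countable_bigcup R d T P _ (trajectories p B s)
    (fun t => [set w | mkseq (X ^~ w) (size t).+1 = rcons t x]).
  by have := triv setT; under eq_fun do rewrite setTI.
move=> E mE; rewrite eqU setI_bigcupr.
have [|//|_] := @measure_countable_bigcup R d T P _ (trajectories p B s)
    (fun t => E `&` [set w | mkseq (X ^~ w) (size t).+1 = rcons t x]).
  by move=> t _; exact: measurableI.
exact.
Qed.

(** A product formula replaces conditioning on [E], an event which will record the previous branches
    and the prescribed beginnings of walks. *)
Lemma branch_law (X : nat -> T -> G) B v s x E (a : \bar R) :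
  (forall i x, measurable [set w | X i w = x]) -> measurable E -> 0 <= a ->
  (forall t, P (E `&` [set w | mkseq (X ^~ w) (size t).+1 = v :: t]) =
             a * (jump_path (v :: t))%:E) ->
  uniq (v :: s) -> x != last v s -> (x \in B) || closes_NC p (v :: s) x ->
  P (E `&` [set w | branch p B (X ^~ w) = Some (rcons (v :: s) x)]) =
  a * ((q_path (rcons (v :: s) x))%:E * loop_prod p B (v :: s)).
Proof.
move=> mX mE a0 PE us xs sx; have [_ ->] // := branch_event mX sx.
rewrite -esum_trajectories_rcons // -esumZl //; last first.
  by move=> t; rewrite lee_fin q_path_ge0.
apply: eq_esum => t /trajectories_last[t' [-> tl]].
have -> : size (v :: t') = size (rcons t' x) by rewrite size_rcons.
by rewrite rcons_cons PE -rcons_cons jump_path_q ?tl.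
Qed.

Lemma branch_pathP B v eta : v \notin B -> branch_path p B v eta ->
  exists s x, [/\ eta = rcons (v :: s) x, uniq (v :: s), x != last v s &
                  (x \in B) || closes_NC p (v :: s) x].
Proof.
move=> vB [[|a s] [x [-> /= hx adj us stop]]].
  by move: stop; rewrite /closes_NC /= orbF hx (negbTE vB).
subst a; exists s, x; split => //; last first.
  by case/orP: stop => [/andP[_ ->]|->] //; rewrite orbT.
move: adj; rewrite rcons_path => /andP[_].
by apply: contraTneq => ->; rewrite adj_irr.
Qed.

Lemma q_path_avoids_bdv v s x : q_path (rcons (v :: s) x) != 0%R :> R ->
  all (fun x => x \notin bdv G) (v :: s).
Proof.
elim: s v => [|y s IHs] v; rewrite rcons_cons q_path_cons mulf_eq0 negb_or => /andP[qv].
  by rewrite /= andbT => _; move: qv; apply: contra => vb; rewrite /q wt_bdv // mul0r.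
move=> /IHs av; rewrite -[v :: _]cat1s all_cat av andbT /= andbT.
by move: qv; apply: contra => vb; rewrite /q wt_bdv // mul0r.
Qed.

(** The end of a branch lies in [B] or repeats an earlier vertex, so no further loop has it as first
    hit. *)
Lemma loop_exp_rcons B v s x : (x \in B) || closes_NC p (v :: s) x ->
  loop_exp p B (rcons (v :: s) x) = loop_exp p B (v :: s).
Proof.
move=> sx; rewrite -cats1 loop_exp_cat loop_exp1_visited ?mule1 //.
by rewrite !inE; case/orP: sx => [->|/closes_NC_mem] //; rewrite inE => ->; rewrite orbT.
Qed.

Lemma Lambda_eta_contractible etas :
  Lambda (intersects [set x in flatten etas]%SET `&` eta_contractible p etas) =
  Lambda (first_hit_loops p (bdv G) (flatten etas)) :> \bar R.
Proof.
congr (\esum_(c in _) _); apply/seteqP; split => c [rc].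
  move=> [ic [_ H]]; split => //; split => //; first exact: rooted_loop_bdv.
  by case/hasP: ic => x xc; rewrite /= inE => xu; apply/hasP; exists x.
move=> [cb hc H]; have ic : intersects [set x in flatten etas]%SET c.
  by case/hasP: hc => x xc xu; apply/hasP; exists x => //=; rewrite inE.
by split => //; split => //; split => // i x; exact: H.
Qed.

(* Recurrence cannot make the loop weights infinite when a branch has positive
   weight, since the left-hand side is a probability. *)
Lemma probability_lty (E : set T) (a : R) (L : \bar R) : measurable E ->
  (0 < a)%R -> P E = a%:E * L -> L < +oo.
Proof.
move=> mE a0 PE; rewrite ltey; apply/eqP => Ly.
have := probability_le1 P mE; rewrite PE Ly gt0_muley ?lte_fin // leye_eq.
Qed.

Lemma first_branch_law v (X : nat -> T -> G) eta : v \notin bdv G ->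
  random_walk P v X -> branch_path p (bdv G) v eta ->
  P [set w | branch p (bdv G) (X ^~ w) = Some eta] =
  (q_path eta)%:E * loop_exp p (bdv G) eta.
Proof.
move=> vb [mX PX] /(branch_pathP vb)[s [x [-> us xs sx]]].
have [mB _] := branch_event mX sx.
have PB : P [set w | branch p (bdv G) (X ^~ w) = Some (rcons (v :: s) x)] =
    (q_path (rcons (v :: s) x))%:E * loop_prod p (bdv G) (v :: s).
  rewrite -[X in P X]setTI (branch_law (a := 1) (v := v)) ?mul1e //.
  by move=> t; rewrite setTI PX mul1e.
rewrite PB loop_exp_rcons //.
(* At weight zero both sides vanish, even if the loop mass is infinite; otherwise the probability
   bound makes the loop product finite. *)
have [->|q0] := eqVneq (q_path (rcons (v :: s) x)) 0%R; first by rewrite !mul0e.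
rewrite loop_prod_exp //; first exact: q_path_avoids_bdv q0.
by apply: probability_lty mB _ PB; rewrite lt_neqAle eq_sym q0 q_path_ge0.
Qed.

End BranchLaw.

(** * Wilson's algorithm *)

Section WilsonLaw.
Variables (R : realType) (S : bordered_surface R).
Variables (p : universal_covering S) (G : embedded_graph S).
Variables (d : measure_display) (T : measurableType d) (P : probability T R).
Implicit Types (x v : G) (s t eta : seq G) (B : {set G}) (etas : seq (seq G)).
Implicit Types (sigma : G -> seq G).

Lemma steps_fst v s x :
  [seq e.1 | e <- steps (rcons (v :: s) x)] = v :: s.
Proof. by elim: s v => [|y s IHs] v //=; congr cons; exact: IHs. Qed.

(** The edges of the branch start at distinct vertices outside the earlier branches, so none of them
    is repeated or already counted. *)
Lemma q_union_rcons etas v s x :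
  uniq (v :: s) -> all (fun y => y \notin flatten etas) (v :: s) ->
  q_union (rcons etas (rcons (v :: s) x)) =
  (q_union etas * q_path (rcons (v :: s) x))%R :> R.
Proof.
move=> us av; rewrite /q_union map_rcons flatten_rcons.
set st := steps _; set old := flatten _.
have ust : uniq st by apply: (@map_uniq _ _ fst); rewrite steps_fst.
have dis : fintype.disjoint (mem [set e in old]%SET) (mem [set e in st]%SET).
  apply/pred0P => e /=; rewrite !inE; apply/negP => /andP[/flatten_mapP[eta etain ein]].
  move=> /(map_f fst); rewrite steps_fst => /(allP av) /negP; apply.
  apply/flattenP; exists eta => //.
  rewrite /steps in ein; elim: (eta) (behead eta) ein => [|y t IHt] [|z u] //=.
  by rewrite !inE => /orP[/eqP -> /=|/IHt ->]; rewrite ?eqxx ?orbT.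
have -> : [set e in old ++ st]%SET = ([set e in old] :|: [set e in st])%SET.
  by apply/setP => e; rewrite !inE mem_cat.
rewrite (eq_bigl [predU [set e in old]%SET & [set e in st]%SET]); last first.
  by move=> e; rewrite !inE.
rewrite bigU //=; congr (_ * _)%R.
by rewrite /q_path (big_uniq _ ust) /=; apply: eq_bigl => e; rewrite inE.
Qed.

Lemma wilson_rcons start (X : G -> nat -> G) etas eta :
  wilson p start X (size (rcons etas eta)) = Some (rcons etas eta) <->
  wilson p start X (size etas) = Some etas /\
  branch p (explored etas) (X (start etas)) = Some eta.
Proof.
rewrite size_rcons /=; split=> [|[-> /= ->] //].
case: (wilson _ _ _ _) => //= etas'; case E: (branch _ _ _) => //= -[].
by move=> /rcons_inj[<- <-].
Qed.

Lemma candidates_rcons start etas eta : candidates p start (rcons etas eta) ->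
  [/\ candidates p start etas, start etas \notin explored etas,
      branch_path p (explored etas) (start etas) eta &
      forall j, (j.+1 < size eta)%N ->
        nth (start etas) eta j \notin explored etas].
Proof.
move=> C; have := C (size etas); rewrite size_rcons ltnSn => /(_ isT) /=.
rewrite -cats1 take_size_cat // nth_cat ltnn subnn /= => -[? ? ?]; split => // i ie.
have := C i; rewrite size_rcons ltnS ltnW // => /(_ isT) /=.
by rewrite -cats1 takel_cat ?(ltnW ie) // nth_cat ie.
Qed.

Lemma mem_start_candidates start etas k : candidates p start etas ->
  (k < size etas)%N -> start (take k etas) \in explored etas.
Proof.
move=> C ks; have [_ [s [x [eE hx _ _ _]]] _] := C k ks.
rewrite !inE; apply/orP; right; apply/flattenP.
exists (nth [::] etas k); first exact: mem_nth.
by rewrite -{1}hx eE; case: (s) => [|a s'] /=; rewrite mem_head.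
Qed.

Lemma jump_path_ge0 s : (0 <= jump_path s)%R.
Proof.
rewrite prodr_ge0 // => e _; rewrite /jump; case: ifP => _; last exact: q_ge0.
exact: ler0n.
Qed.

Lemma jump_path_seq1 v : jump_path [:: v] = 1%R :> R.
Proof. by rewrite /jump_path /steps /= big_nil. Qed.

Definition cylinders (X : G -> nat -> T -> G) sigma : set T :=
  [set w | forall v, mkseq (X v ^~ w) (size (sigma v)).+1 = v :: sigma v].

Lemma measurable_cylinders X sigma :
  (forall v i x, measurable [set w | X v i w = x]) ->
  measurable (cylinders X sigma).
Proof.
move=> mX.
rewrite (_ : cylinders X sigma = \bigcap_(v in [set: G])
    [set w | mkseq (X v ^~ w) (size (sigma v)).+1 = v :: sigma v]).
  apply: fin_bigcap_measurable => [|v _]; first exact: finite_finset.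
  exact: measurable_mkseq.
by apply/seteqP; split => w H v; [move=> _|]; exact: H.
Qed.

(* sigma prescribes the beginning of the walks that have not been used yet,
   which gives the next branch its law conditionally on the previous ones.
   L stands for the product of the loop weights; it may be +oo if q_union etas
   is 0. *)
Lemma wilson_law start (X : G -> nat -> T -> G) etas :
  independent_walks P X -> candidates p start etas ->
  measurable [set w | wilson p start (fun v i => X v i w) (size etas) = Some etas] /\
  exists L, [/\ 1 <= L, L < +oo -> L = loop_exp p (bdv G) (flatten etas) &
    forall sigma, (forall k, (k < size etas)%N -> sigma (start (take k etas)) = [::]) ->
    P ([set w | wilson p start (fun v i => X v i w) (size etas) = Some etas] `&`
       cylinders X sigma) =
    (q_union etas)%:E * L * (\prod_v jump_path (v :: sigma v))%:E].
Proof.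
move=> [mX PX].
elim/last_ind: etas => [_|etas eta IH].
  split; first by rewrite (_ : [set w | _] = setT) //; apply/seteqP; split.
  exists 1; split => //; first by rewrite loop_exp_nil.
  move=> sigma _; rewrite (_ : [set w | _] = setT); last by apply/seteqP; split.
  have -> : q_union ([::] : seq (seq G)) = 1%R.
    by rewrite /q_union big_pred0 // => e; rewrite inE.
  by rewrite setTI PX !mul1e.
move=> /candidates_rcons[/[dup] C /IH[mW [L [L1 Lfin PL]]] sv bp av].
have [s [x [etaE us xs stop]]] := branch_pathP sv bp.
set v0 := start etas in sv bp av us xs etaE stop *.
set B := explored etas in sv bp av stop *.
have aB : all (fun x => x \notin B) (v0 :: s).
  apply/(all_nthP v0) => j js; have := av j; rewrite etaE size_rcons ltnS => /(_ js).
  by rewrite nth_rcons js.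
have [mB _] := branch_event P (mX v0) stop.
have eqW : [set w | wilson p start (fun v i => X v i w) (size (rcons etas eta)) =
      Some (rcons etas eta)] =
    [set w | wilson p start (fun v i => X v i w) (size etas) = Some etas] `&`
    [set w | branch p B (X v0 ^~ w) = Some (rcons (v0 :: s) x)].
  apply/seteqP; split => w; first by move=> /wilson_rcons; rewrite etaE.
  by rewrite -etaE => ?; apply/wilson_rcons.
rewrite eqW; split; first exact: measurableI.
exists (L * loop_prod p B (v0 :: s)).
have l1 := loop_prod_ge1 p us aB.
have L0 : 0 <= L by exact: le_trans L1.
have l0 : 0 <= loop_prod p B (v0 :: s) by exact: loop_prod_ge0.
split.
- by rewrite -[X in X <= _]mule1 lee_pmul.
- move=> fin.
  have Lf : L < +oo.
    by apply: le_lt_trans fin; rewrite -[X in X <= _]mule1 lee_pmul.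
  have lf : loop_prod p B (v0 :: s) < +oo.
    by apply: le_lt_trans fin; rewrite -[X in X <= _]mul1e lee_pmul.
  rewrite etaE flatten_rcons loop_exp_cat -[(_ :|: _)%SET]/B loop_exp_rcons //.
  by rewrite -(Lfin Lf) loop_prod_exp.
move=> sigma sigma0.
have sigma0' k : (k < size etas)%N -> sigma (start (take k etas)) = [::].
  move=> ks; have := sigma0 k; rewrite size_rcons ltnS ltnW //.
  by rewrite -cats1 takel_cat ?(ltnW ks) // => ->.
have sv0 : sigma v0 = [::].
  by have := sigma0 (size etas); rewrite size_rcons ltnSn -cats1 take_size_cat // => ->.
rewrite setIAC.
have qu0 : 0 <= (q_union etas)%:E.
  by rewrite lee_fin /q_union prodr_ge0 // => e _; exact: q_ge0.
(* [J] is the weight prescribed to the other walks; the walk from [v0] serves for the new branch,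
   and [sigma] leaves it free. *)
pose J := (\prod_(v | v != v0) jump_path (v :: sigma v))%R.
have J0 : (0 <= J)%R by rewrite prodr_ge0 // => v _; exact: jump_path_ge0.
rewrite (branch_law (a := (q_union etas)%:E * L * J%:E) (v := v0)) //.
- have -> : (\prod_v jump_path (v :: sigma v) = J)%R.
    by rewrite (bigD1 v0) //= sv0 jump_path_seq1 mul1r.
  rewrite etaE q_union_rcons //; last first.
    by apply: sub_all aB => y; rewrite !inE negb_or => /andP[].
  by rewrite EFinM (muleAC _ J%:E) (muleACA (q_union etas)%:E).
- exact: (measurableI _ _ mW (measurable_cylinders _ mX)).
- by rewrite !mule_ge0 // lee_fin.
(* Prescribing [t] to the walk from [v0] is compatible with the induction hypothesis, since [v0]
   differs from all earlier starting vertices. *)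
- move=> t; pose sigma' v := if v == v0 then t else sigma v.
  rewrite -setIA.
  have -> : cylinders X sigma `&`
      [set w | mkseq (X v0 ^~ w) (size t).+1 = v0 :: t] = cylinders X sigma'.
    apply/seteqP; split => w.
      by move=> [H H0] v; rewrite /sigma'; case: eqP => [->|].
    move=> H; split => [v|]; last by have := H v0; rewrite /sigma' eqxx.
    have := H v; rewrite /sigma'; case: eqP => // ->.
    by rewrite sv0 /mkseq /= => -[->].
  rewrite PL; last first.
    move=> k ks; rewrite /sigma' sigma0' //; case: eqP => // v0E.
    by rewrite -v0E (mem_start_candidates C ks) in sv.
  rewrite -[RHS]muleA -EFinM; congr (_ * _%:E).
  rewrite (bigD1 v0) //= {1}/sigma' eqxx mulrC; congr (_ * _)%R.
  by apply: eq_bigr => v /negbTE vv0; rewrite /sigma' vv0.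
Qed.

Lemma candidates_law start (X : G -> nat -> T -> G) etas :
  independent_walks P X -> candidates p start etas ->
  P [set w | wilson p start (fun v i => X v i w) (size etas) = Some etas] =
  (q_union etas)%:E * loop_exp p (bdv G) (flatten etas).
Proof.
move=> iX C; have [mX PX] := iX; have [mW [L [_ LE PL]]] := wilson_law iX C.
(* The empty prescription still says that each [X v] starts at [v]. This holds only almost surely,
   so its complement is shown to be negligible. *)
pose sigma0 (v : G) : seq G := [::].
have P1 : P (cylinders X sigma0) = 1.
  by rewrite /cylinders PX big1 // => v _; exact: jump_path_seq1.
have mc : measurable (cylinders X sigma0) by exact: measurable_cylinders.
have PE : P [set w | wilson p start (fun v i => X v i w) (size etas) = Some etas] =
    (q_union etas)%:E * L.
  have := PL sigma0 (fun _ _ => erefl).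
  rewrite big1 ?mule1; last by move=> v _; exact: jump_path_seq1.
  move=> <-; rewrite (measureDI P mW mc) -[RHS]add0e; congr (_ + _); apply/eqP.
  rewrite -measure_le0; apply: (@le_trans _ _ (P (~` cylinders X sigma0))).
    apply: le_measure; rewrite ?inE; [exact: measurableD|exact: measurableC|].
    by move=> w [].
  by rewrite probability_setC // P1 subee.
have [q0|q0] := eqVneq (q_union etas : R) 0%R; first by rewrite PE q0 !mul0e.
rewrite PE LE //; apply: probability_lty mW _ PE.
rewrite lt_neqAle eq_sym q0 /q_union prodr_ge0 // => e _; exact: q_ge0.
Qed.

End WilsonLaw.

Theorem theorem4p7 (R : realType) (S : bordered_surface R)
    (p : universal_covering S) (hS : torus_or_hyperbolic p)
    (G : embedded_graph S)
    (d : measure_display) (T : measurableType d) (P : probability T R) :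
  (forall (v : G) (X : nat -> T -> G) (eta : seq G),
     v \notin bdv G ->
     random_walk P v X ->
     branch_path p (bdv G) v eta ->
     P [set w | branch p (bdv G) (X ^~ w) = Some eta] =
     (q_path eta)%:E *
     expeR (Lambda (intersects [set x in eta]%SET `&`
                    eta_contractible p [:: eta]))) /\
  (forall (start : seq (seq G) -> G) (X : G -> nat -> T -> G)
     (etas : seq (seq G)),
     starts_new start ->
     independent_walks P X ->
     candidates p start etas ->
     P [set w | wilson p start (fun v t => X v t w) (size etas) = Some etas] =
     (q_union etas)%:E *
     expeR (Lambda (intersects [set x in flatten etas]%SET `&`
                    eta_contractible p etas))).
Proof.
split=> [v X eta vb rX bp|start X etas _ iX C].
  have := Lambda_eta_contractible p [:: eta]; rewrite [flatten _]cats0 => ->.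
  exact: (first_branch_law vb rX bp).
by rewrite Lambda_eta_contractible; exact: (candidates_law iX C).
Qed.
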